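(* Let $K\subset\mathbb{R}^N$ be a $C^2_+$-regular convex body that is symmetric with respect to the origin, and let $\Omega\subset\mathbb{R}^N$ be a convex body. Then $$\lambda_1^K(\Omega)\ \le\ \lambda_1(B)\,(R_\Omega^K)^{-2}.$$
   Context: A convex body is a compact convex subset of $\mathbb{R}^N$ with nonempty interior. A convex body $K$ is $C^2_+$-regular if its boundary can be written locally as the graph of a $C^2$ function with positive definite Hessian. The support function of $K$ is $h_K(x)=\max\{x\cdot y : y\in K\}$; when $K$ is symmetric with respect to the origin, $h_K$ is a norm. The $K$-principal frequency of $\Omega$ is $$\lambda_1^K(\Omega)=\min_{u\in W_0^{1,2}(\Omega)\setminus\{0\}}\frac{\int_\Omega h_K^2(\nabla u)\,dx}{\int_\Omega u^2\,dx},$$ where, for a convex body $\Omega$, $W_0^{1,2}(\Omega)$ is the Sobolev space $W^{1,2}_0$ of the interior of $\Omega$. $B$ is the Euclidean unit ball of $\mathbb{R}^N$ and $\lambda_1(B)$ is the first Dirichlet eigenvalue of $-\Delta$ on $B$. The anisotropic inradius $R_\Omega^K$ is the largest $t$ such that $x+tK\subseteq\Omega$ for some $x\in\Omega$. *)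

(* Defs.v *)
From HB Require Import structures.
From mathcomp Require Import all_boot all_order all_algebra.
From mathcomp Require Import all_classical all_reals all_analysis.

Set Implicit Arguments.
Unset Strict Implicit.
Unset Printing Implicit Defensive.

Import Order.TTheory GRing.Theory Num.Theory.
Import numFieldNormedType.Exports.

Local Open Scope classical_set_scope.
Local Open Scope ring_scope.

(* Lebesgue measure on R^n, built on n-tuples (which carry the product
   sigma-algebra) by iterating the binary product measure. *)
Section LebesgueMeasure.
Variable R : realType.
Local Open Scope ereal_scope.

Let T := measurableTypeR R.

Definition tcons n (p : T * n.-tuple T) : n.+1.-tuple T :=
  [tuple of p.1 :: p.2].

Lemma measurable_tcons n : measurable_fun setT (@tcons n).
Proof. by apply: measurable_cons. Qed.

(* The library's sigma-finite structure on \x is not inferred here: the one it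
   declares for subprobabilities takes precedence. *)
Lemma product_sigma_finite d1 d2 (T1 : measurableType d1)
    (T2 : measurableType d2) (m1 : {sigma_finite_measure set T1 -> \bar R})
    (m2 : {sigma_finite_measure set T2 -> \bar R}) :
  sigma_finite setT (m1 \x m2).
Proof.
have /sigma_finiteP[F [TF ndF Foo]] := sigma_finiteT m1.
have /sigma_finiteP[G [TG ndG Goo]] := sigma_finiteT m2.
exists (fun n => F n `*` G n).
  rewrite -setXTT TF TG predeqE => -[x y]; split.
    move=> [/= [n _ Fnx] [k _ Gky]]; exists (maxn n k) => //; split.
    - by move: x Fnx; exact/subsetPset/ndF/leq_maxl.
    - by move: y Gky; exact/subsetPset/ndG/leq_maxr.
  by move=> [n _ []/= ? ?]; split; exists n.
move=> k; have [? ?] := Foo k; have [? ?] := Goo k.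
split; first exact: measurableX.
by rewrite product_measure1E// lte_mul_pinfty// ge0_fin_numE.
Qed.

Section succ.
Variables (n : nat) (mu : {sigma_finite_measure set (n.-tuple T) -> \bar R}).

Definition leb_succ : set (n.+1.-tuple T) -> \bar R :=
  pushforward (@lebesgue_measure R \x mu) (@tcons n).

Let measurable_preimage_tcons (A : set (n.+1.-tuple T)) :
  measurable A -> measurable (@tcons n @^-1` A).
Proof. by move=> mA; rewrite -[X in measurable X]setTI; apply: measurable_tcons. Qed.

Let leb_succ0 : leb_succ set0 = 0.
Proof. by rewrite /leb_succ /pushforward preimage_set0 measure0. Qed.

Let leb_succ_ge0 A : 0 <= leb_succ A.
Proof. by rewrite /leb_succ /pushforward; apply: measure_ge0. Qed.

Let leb_succ_sigma_additive : semi_sigma_additive leb_succ.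
Proof.
move=> F mF tF mUF; rewrite /leb_succ /pushforward preimage_bigcup.
apply: measure_semi_sigma_additive.
- by move=> i; exact: measurable_preimage_tcons.
- apply/trivIsetP => /= i j _ _ ij.
  rewrite -preimage_setI.
  by move/trivIsetP : tF => /(_ _ _ _ _ ij) ->//; rewrite preimage_set0.
- by rewrite -preimage_bigcup; exact: measurable_preimage_tcons.
Qed.

HB.instance Definition _ := isMeasure.Build _ _ _ leb_succ
  leb_succ0 leb_succ_ge0 leb_succ_sigma_additive.

Let leb_succ_sigma_finite : sigma_finite setT leb_succ.
Proof.
have [F FT mF] : sigma_finite setT (@lebesgue_measure R \x mu).
  exact: product_sigma_finite.
pose s (t : n.+1.-tuple T) : T * n.-tuple T := (thead t, [tuple of behead t]).
have ms : measurable_fun setT s.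
  by apply/measurable_fun_pair => /=; [exact: measurable_tnth|
    exact: measurable_behead].
have sK (p : T * n.-tuple T) : s (tcons p) = p.
  by case: p => x t; congr pair; apply/val_inj.
exists (fun i => s @^-1` F i); first by rewrite -preimage_bigcup -FT preimage_setT.
move=> i; have [mFi Foo] := mF i; split.
  by rewrite -[X in measurable X]setTI; apply: ms.
rewrite /leb_succ /pushforward -comp_preimage.
by rewrite (_ : s \o @tcons n = id)//; apply/funext => p /=; exact: sK.
Qed.

HB.instance Definition _ := Measure_isSigmaFinite.Build _ _ _ leb_succ
  leb_succ_sigma_finite.

End succ.

Fixpoint leb n : {sigma_finite_measure set (n.-tuple T) -> \bar R} :=
  match n with
  | 0 => dirac ([tuple] : 0.-tuple T)
  | n'.+1 => leb_succ (leb n')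
  end.

End LebesgueMeasure.

Section Space.
Variables (R : realType) (N : nat).
Implicit Types (x y : 'rV[R]_N) (A U V K Omega : set 'rV[R]_N).
Implicit Types (u v f phi : 'rV[R]_N -> R) (g h : 'rV[R]_N -> 'rV[R]_N).

Definition dot x y : R := \sum_i x ord0 i * y ord0 i.

(* The norm `|x| of the library on row vectors is the sup norm. *)
Definition enorm x : R := Num.sqrt (dot x x).

Definition unit_ball : set 'rV[R]_N := [set x | enorm x <= 1].

Definition convex_body A :=
  [/\ compact A, convex_set (A : set (convex_lmodType 'rV[R]_N))
    & A° !=set0].

Definition origin_symmetric A := forall x, A x -> A (- x).

Definition support_function K x : R := sup [set dot x y | y in K].

(* When K and Omega are convex bodies and N > 0 the sup is attained, so this is
   the largest t. *)
Definition inradius K Omega : R :=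
  sup [set t | 0 <= t /\
    exists2 x, Omega x & forall y, K y -> Omega (x + t *: y)].

Definition partial (i : 'I_N) f : 'rV[R]_N -> R :=
  fun x => 'D_(delta_mx ord0 i) f x.

Definition gradient f : 'rV[R]_N -> 'rV[R]_N :=
  fun x => \row_i partial i f x.

Definition hessian f x : 'M[R]_N :=
  \matrix_(i, j) partial i (partial j f) x.

(* f is of class C^k on the open set V *)
Fixpoint is_Ck (k : nat) V f : Prop :=
  (forall x, V x -> {for x, continuous f}) /\
  (if k is k'.+1 then
     forall i : 'I_N, (forall x, V x -> derivable f x (delta_mx ord0 i)) /\
       is_Ck k' V (partial i f)
   else True).

Definition posdef (M : 'M[R]_N) :=
  forall x, x != 0 -> 0 < (x *m M *m x^T) ord0 ord0.

(* C_c^oo(U), its elements being extended by zero to the whole space *)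
Definition test_function U phi :=
  [/\ forall k, is_Ck k setT phi,
      compact (closure [set x | phi x != 0])
    & closure [set x | phi x != 0] `<=` U].

Definition tuple_row (t : N.-tuple (measurableTypeR R)) : 'rV[R]_N :=
  \row_i (tnth t i : R).

(* Integrals over U; rint is meaningful for integrable f only. *)
Definition eint U f : \bar R :=
  \int[leb R N]_(t in tuple_row @^-1` U) (f (tuple_row t))%:E.

Definition rint U f : R := fine (eint U f).

Definition ae_zero U u :=
  {ae leb R N, forall t, U (tuple_row t) -> u (tuple_row t) = 0}.

Definition L2 U u :=
  measurable_fun (tuple_row @^-1` U) (u \o tuple_row) /\
  (eint U (fun x => u x ^+ 2)%R < +oo)%E.

Definition weak_gradient U u g :=
  forall phi, test_function U phi -> forall i : 'I_N,
    rint U (fun x => u x * partial i phi x) =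
    - rint U (fun x => g x ord0 i * phi x).

(* An element of W^{1,2}(U) is handled as a function u together with its weak
   gradient g (both are determined up to null sets). *)
Definition W12 U u g :=
  [/\ L2 U u, forall i : 'I_N, L2 U (fun x => g x ord0 i)
    & weak_gradient U u g].

(* squared W^{1,2}(U) norm of u, where g is the weak gradient of u *)
Definition W12_norm2 U u g : \bar R :=
  eint U (fun x => u x ^+ 2 + enorm (g x) ^+ 2).

(* W_0^{1,2}(U), the closure of C_c^oo(U) in W^{1,2}(U) *)
Definition W12_0 U u g :=
  W12 U u g /\
  forall e : R, 0 < e -> exists2 phi, test_function U phi &
    (W12_norm2 U (fun x => phi x - u x)%R (fun x => gradient phi x - g x)%R
      < e%:E)%E.

(* The minimum of the Rayleigh quotient, written as an infimum. *)
Definition principal_frequency K Omega : \bar R :=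
  ereal_inf [set q | exists u g,
    [/\ W12_0 Omega° u g, ~ ae_zero Omega° u &
        q = (rint Omega° (fun x => support_function K (g x) ^+ 2) /
             rint Omega° (fun x => u x ^+ 2))%:E]].

(* mu is an eigenvalue of - Delta on U with Dirichlet boundary condition, in the
   weak sense. *)
Definition dirichlet_eigenvalue U (mu : R) :=
  exists u g, [/\ W12_0 U u g, ~ ae_zero U u &
    forall v h, W12_0 U v h ->
      rint U (fun x => dot (g x) (h x)) = mu * rint U (fun x => u x * v x)].

(* The least eigenvalue, written as an infimum. *)
Definition lambda1 Omega : \bar R :=
  ereal_inf [set mu%:E | mu in dirichlet_eigenvalue Omega°].

End Space.

(* Near each of its points the boundary of K is, in some orthonormal frame (the
   rows of Q), the graph of f over the first coordinate axis: the point of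
   coordinates z in V is lifted to (f z, z). *)
Definition C2_plus (R : realType) (n : nat) (K : set 'rV[R]_n.+1) :=
  forall x, (closure K `\` K°) x ->
    exists (Q : 'M[R]_n.+1) (U : set 'rV[R]_n.+1) (V : set 'rV[R]_n)
           (f : 'rV[R]_n -> R),
    [/\ Q *m Q^T = 1%:M, open U /\ U x, open V,
        is_Ck 2 V f /\ (forall z, V z -> posdef (hessian f z))
      & (closure K `\` K°) `&` U =
        [set (row_mx (f z)%:M z : 'rV[R]_(1 + n)) *m Q | z in V]].

Arguments unit_ball R N : clear implicits.

(* Main.v *)
(* By definition of W_0^{1,2}, an eigenpair (u, mu) of the ball B yields test
   functions phi on B whose Rayleigh quotient is below any given c > mu. In polar
   coordinates this gives a direction theta such that
     \int r^n |grad phi|^2 (r theta) dr < c * \int r^n phi^2 (r theta) dr.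
   If x0 + t K is contained in Omega and p is the gauge of x0 + t K centred at x0,
   then Psi z = phi (p z *: theta) satisfies
     h_K (grad Psi) <= t^-1 |grad phi| (p z *: theta),
   and since p is positively homogeneous, integrals of functions of p z are a
   common multiple of the corresponding ray integrals. Hence the K-Rayleigh
   quotient of Psi is at most c / t^2. To keep Psi a test function, p is replaced
   by smooth convex functions converging uniformly to the gauge of a polytope,
   whose gradients remain in the polar body of t K. *)
Require Import Defs.
From HB Require Import structures.
From mathcomp Require Import all_boot all_order all_algebra.
From mathcomp Require Import finmap.
From mathcomp Require Import all_classical all_reals all_analysis.
From mathcomp Require Import measurable_realfun.
From mathcomp Require Import ring lra.

Set Implicit Arguments.
Unset Strict Implicit.
Unset Printing Implicit Defensive.

Import Order.TTheory GRing.Theory Num.Def Num.Theory.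
Import numFieldNormedType.Exports.

Local Open Scope classical_set_scope.
Local Open Scope ring_scope.

(** The profile [r |-> phi (r theta)] along the selected direction plays the part of a radial
    profile: after transplantation only the component of grad phi along theta appears, and
    Cauchy-Schwarz bounds it by |grad phi|. Directions are selected by averaging over the whole
    space against a weight whose dr/r-mass along every ray is 1, so that inequalities between
    integrals become pointwise inequalities between ray integrals, for the Euclidean ball and for a
    gauge alike. The smoothing of the gauge must keep supports inside Omega and must not spoil the
    gradient bound. Log-sum-exp does both: it lies above the maximum of the linear forms, so
    supports can only shrink, and its gradient is a sub-convex combination of these forms. The forms
    come from a polytope that contains K, while its r-multiple lies inside K; here r < 1 is a radius
    containing the support of phi, and the room between r and 1 pays for the polytope. The strict
    inequality c > mu is spent twice, once on replacing u by phi and once on the smooth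
    approximation of the gauge. *)

(** * Sup norm and measurability of functions of row vectors *)

Lemma coord_le_norm (R : realType) N (x : 'rV[R]_N) i : `|x ord0 i| <= `|x|.
Proof.
by rewrite [leRHS]/normr /= mx_normrE; apply: (le_bigmax _ _ (ord0, i)).
Qed.

Lemma norm_rV_le (R : realType) N (x : 'rV[R]_N) (c : R) : 0 <= c ->
  (forall i, `|x ord0 i| <= c) -> `|x| <= c.
Proof.
move=> c0 xc; rewrite [leLHS]/normr /= mx_normrE; apply/bigmax_leP; split => //.
by move=> [i j] _ /=; rewrite ord1.
Qed.

(** Tuples carry the product sigma-algebra, row vectors the topology. The two are linked by writing
    an open set as a union of boxes with rational centres and radii, a countable family. *)
Lemma measurable_tuple_open (R : realType) N (U : set 'rV[R]_N) : open U ->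
  measurable (@tuple_row R N @^-1` U).
Proof.
move=> oU.
pose box (p : {ffun 'I_N -> rat} * rat) : set (N.-tuple (measurableTypeR R)) :=
  \bigcap_(i : 'I_N) [set t | `|(tnth t i : R) - ratr (p.1 i)| < ratr p.2].
(* Boxes that leave [U] are replaced by the empty set, so that the union runs over the whole
   countable index type. *)
pose F p := if `[< box p `<=` @tuple_row R N @^-1` U >] then box p else set0.
have -> : @tuple_row R N @^-1` U = \bigcup_p F p.
  apply/seteqP; split => [t Ut|t [p _]]; last first.
    by rewrite /F; case: ifPn => // /asboolP; apply.
  have /nbhs_ballP[e /= e0 eU] : nbhs (tuple_row t) U by apply: open_nbhs_nbhs.
  have [r /itvP re] : exists r, ratr r \in `]0, (e / 2)[.
    by apply: rat_in_itvoo; rewrite divr_gt0.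
  have /choice[q qt] : forall i : 'I_N, exists q : rat,
      `|(tnth t i : R) - ratr q| < ratr r.
    move=> i; have [q /itvP qE] : exists q, ratr q \in
        `](tnth t i : R) - ratr r, (tnth t i : R) + ratr r[.
      by apply: rat_in_itvoo; rewrite ltrBlDr -addrA ltrDl addr_gt0 ?re.
    by exists q; rewrite ltr_distlC !qE.
  exists ([ffun i => q i], r) => //; rewrite /F.
  have tb : box ([ffun i => q i], r) t by move=> i _ /=; rewrite ffunE.
  rewrite ifT //; apply/asboolP => s /= sb; apply: eU; split => // i j.
  rewrite ord1 !mxE /ball /=.
  rewrite -(subrKA (ratr (q j))) (le_lt_trans (ler_normD _ _))//.
  rewrite [ltRHS](splitr e); apply: ltrD; first by rewrite (lt_trans (qt j))// re.
  have := sb j I; rewrite /= ffunE distrC => /lt_trans; apply; by rewrite re.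
apply: countable_bigcupT_measurable => // p.
rewrite /F; case: ifPn => // _; apply: fin_bigcap_measurable => // i _.
rewrite -[X in measurable X]setTI.
have mi : measurable_fun setT (fun t : N.-tuple (measurableTypeR R) => tnth t i).
  exact: measurable_tnth.
apply: (mi _ [set s : R | `|s - ratr (p.1 i)| < ratr p.2]) => //.
apply: open_measurable.
rewrite (_ : mkset _ = ball (ratr (p.1 i) : R) (ratr p.2)); last first.
  by apply/seteqP; split => s; rewrite /ball /= distrC.
exact: ball_open.
Qed.

Lemma continuous_measurable_tuple (R : realType) N (f : 'rV[R]_N -> R) :
  continuous f -> measurable_fun setT (f \o @tuple_row R N).
Proof.
move=> cf; apply: (measurability _ (RGenOpens.measurableE R)).
move=> _ [_ [a [b ->] <-]]; rewrite setTI comp_preimage.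
by apply: measurable_tuple_open; move/continuousP: cf; apply; exact: interval_open.
Qed.

(** * Lebesgue measure and integrals under dilations and translations *)

Section LebesgueAffine.
Variable R : realType.
Local Open Scope ereal_scope.
Let T := measurableTypeR R.
Local Notation mu := (@lebesgue_measure R).

Let affine_measurable (r a : R) :
  measurable_fun setT ((fun x => r * x + a)%R : T -> T).
Proof. by apply: measurable_funD => //; apply: measurable_funM. Qed.

(** Uniqueness of Lebesgue measure: the right-hand side is a measure in [A] and gives each half-open
    interval its length. *)
Lemma lebesgue_measure_affine (r a : R) (A : set T) : (0 < r)%R ->
  measurable A ->
  mu A = r%:E * mu ((fun x => r * x + a)%R @^-1` A).
Proof.
move=> r0 mA; pose f := (fun x => r * x + a)%R : T -> T.
have r0' : (0 <= r)%R by exact: ltW.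
pose m (B : set T) : \bar R := r%:E * mu (f @^-1` B).
have mE B : m B = r%:E * mu (f @^-1` B) by [].
have mm0 : m set0 = 0 by rewrite mE preimage_set0 measure0 mule0.
have mge0 B : 0 <= m B by rewrite mE mule_ge0// lee_fin.
have msa : semi_sigma_additive (m : set T -> _).
  move=> F mF tF mUF; rewrite mE preimage_bigcup.
  have -> : (fun n => \sum_(0 <= i < n) m (F i)) =
      (fun n => r%:E * \sum_(0 <= i < n) mu (f @^-1` F i)).
    by apply/funext => n; rewrite ge0_sume_distrr.
  apply: cvgeZl => //.
  apply: measure_semi_sigma_additive.
  - by move=> i; rewrite -[X in measurable X]setTI; exact: affine_measurable.
  - apply/trivIsetP => /= i j _ _ ij; rewrite -preimage_setI.
    by move/trivIsetP : tF => /(_ _ _ _ _ ij) ->//; rewrite preimage_set0.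
  - rewrite -preimage_bigcup -[X in measurable X]setTI.
    exact: affine_measurable.
pose M := isMeasure.Build _ _ _ m mm0 mge0 msa.
pose m' : {measure set T -> \bar R} := HB.pack m M.
rewrite -mE (_ : m = m')//; apply: lebesgue_measure_unique => //.
move=> _ [[x y] _ <-] /=; rewrite -/m mE.
have -> : f @^-1` `]x, y] = `](r^-1 * (x - a))%R, (r^-1 * (y - a))%R]%classic.
  apply/seteqP; split => z /=; rewrite !in_itv /= /f.
    by rewrite ltr_pdivrMl// ler_pdivlMl// ltrBlDr lerBrDr.
  by rewrite ltr_pdivrMl// ler_pdivlMl// ltrBlDr lerBrDr.
rewrite !lebesgue_measure_itv /= !lte_fin ltr_pM2l ?invr_gt0// ltrD2r.
case: ifP => _; last by rewrite mule0.
by rewrite -!EFinB -EFinM -mulrBr mulrA divff ?gt_eqF// mul1r; congr EFin; ring.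
Qed.

Lemma ge0_integral_lebesgue_affine (G : T -> \bar R) (r a : R) : (0 < r)%R ->
  measurable_fun setT G -> (forall x, 0 <= G x) ->
  \int[mu]_x G (r * x + a)%R = (r^-1)%:E * \int[mu]_x G x.
Proof.
move=> r0 mG G0; pose f := (fun x => r * x + a)%R : T -> T.
have r0' : (0 <= r)%R by exact: ltW.
transitivity (\int[pushforward mu f]_x G x).
  by rewrite ge0_integral_pushforward//; exact: affine_measurable.
have r0i : (0 <= r^-1)%R by rewrite invr_ge0.
rewrite -[(r^-1)%:E]/((NngNum r0i)%:num)%:E -ge0_integral_mscale//.
apply: eq_measure_integral => [|? A mA _]; first exact: affine_measurable.
rewrite /mscale/= [RHS](_ : _ = (r^-1)%:E * mu A)//.
by rewrite (lebesgue_measure_affine a r0 mA) muleA -EFinM mulVf ?gt_eqF// mul1e.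
Qed.

Lemma ge0_integral_leb_succ n (F : n.+1.-tuple T -> \bar R) :
  measurable_fun setT F -> (forall t, 0 <= F t) ->
  \int[leb R n.+1]_t F t = \int[mu]_x \int[leb R n]_t F (tcons (x, t)).
Proof.
move=> mF F0.
transitivity (\int[mu \x leb R n]_p F (tcons p)).
  by rewrite (ge0_integral_pushforward (@measurable_tcons R n)).
have mFt : measurable_fun setT (F \o @tcons R n).
  by apply: measurableT_comp => //; exact: measurable_tcons.
by rewrite (fubini_tonelli1 _ mFt (fun p => F0 _)).
Qed.

Definition affine_tuple n (r : R) (a : n.-tuple T) (t : n.-tuple T) : n.-tuple T :=
  [tuple (r * tnth t i + tnth a i)%R | i < n].

Lemma measurable_affine_tuple n (r : R) (a : n.-tuple T) :
  measurable_fun setT (affine_tuple r a).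
Proof.
apply/measurable_fun_tnthP => i.
rewrite (_ : _ \o _ = fun t => (r * tnth t i + tnth a i)%R); last first.
  by apply/funext => t; rewrite /= tnth_mktuple.
by apply: measurable_funD => //; apply: measurable_funM => //; exact: measurable_tnth.
Qed.

Lemma affine_tuple_tcons n (r : R) (a : n.+1.-tuple T) x (t : n.-tuple T) :
  affine_tuple r a (tcons (x, t)) =
  tcons ((r * x + thead a)%R, affine_tuple r [tuple of behead a] t).
Proof.
apply/eq_from_tnth => i; rewrite tnth_mktuple.
have [j ->|->] := unliftP ord0 i; last by rewrite !tnth0.
rewrite !tnthS !tnth_mktuple tnth_behead (_ : inord j.+1 = lift ord0 j)//.
by apply/val_inj; rewrite /= inordK// ltnS.
Qed.

(** One coordinate at a time, by Tonelli; each contributes a factor [r^-1]. With [a] zero this is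
    the dilation behind polar coordinates, with [r = 1] it is translation invariance. *)
Lemma ge0_integral_leb_affine n (F : n.-tuple T -> \bar R) (r : R) (a : n.-tuple T) :
  (0 < r)%R -> measurable_fun setT F -> (forall t, 0 <= F t) ->
  \int[leb R n]_t F (affine_tuple r a t) = (r ^- n)%:E * \int[leb R n]_t F t.
Proof.
move=> r0; elim: n F a => [|n IH] F a mF F0.
  rewrite expr0 invr1 mul1e; apply: eq_integral => t _.
  by rewrite [affine_tuple r a t]tuple0 [t]tuple0.
have mFc x : measurable_fun setT (fun t : n.-tuple T => F (tcons (x, t))).
  apply: (measurableT_comp mF); apply: (measurableT_comp (@measurable_tcons R n)).
  exact: measurable_pair1.
rewrite !ge0_integral_leb_succ//; last first.
  by apply: measurableT_comp => //; exact: measurable_affine_tuple.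
have mG : measurable_fun setT (fun x : T => \int[leb R n]_t F (tcons (x, t))).
  apply: (measurable_fun_fubini_tonelli_F (F \o @tcons R n)) => [|p]; last exact: F0.
  by apply: measurableT_comp => //; exact: measurable_tcons.
transitivity (\int[mu]_x ((r ^- n)%:E *
    \int[leb R n]_t F (tcons ((r * x + thead a)%R, t)))).
  apply: eq_integral => x _.
  rewrite -(IH _ [tuple of behead a])//.
  by apply: eq_integral => t _; rewrite affine_tuple_tcons.
rewrite ge0_integralZl//.
- rewrite (@ge0_integral_lebesgue_affine
    (fun x => \int[leb R n]_t F (tcons (x, t))) r (thead a))//.
    by rewrite muleA -EFinM -invfM exprSr.
  by move=> x; apply: integral_ge0.
- exact: (measurableT_comp mG (affine_measurable r (thead a))).
- by move=> x _; apply: integral_ge0.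
- by rewrite lee_fin invr_ge0 exprn_ge0// ltW.
Qed.

Lemma measurable_cube n (c : R) :
  measurable [set t : n.-tuple T | forall i, (`|(tnth t i : R)| <= c)%R].
Proof.
rewrite (_ : mkset _ = \bigcap_(i : 'I_n)
    (fun t : n.-tuple T => tnth t i) @^-1` `[(- c)%R, c]%classic).
  apply: fin_bigcap_measurable => // i _.
  by rewrite -[X in measurable X]setTI; apply: measurable_tnth.
apply/seteqP; split => t /= h i; first by move=> _ /=; rewrite in_itv /= -ler_norml.
by have := h i I; rewrite /= in_itv /= -ler_norml.
Qed.

(** Cubes supply the explicit volumes used later: side 0 shows that the origin is null in positive
    dimension, finite volume gives integrability on bounded sets, and positive volume gives
    positivity of integrals. *)
Lemma leb_cube n (c : R) : (0 <= c)%R ->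
  leb R n [set t | forall i, (`|(tnth t i : R)| <= c)%R] = ((c *+ 2) ^+ n)%:E.
Proof.
move=> c0; elim: n => [|n IH].
  by rewrite expr0 /= diracE mem_set//= => -[].
have I1 : mu `[(- c)%R, c]%classic = (c *+ 2)%:E.
  rewrite lebesgue_measure_itv /= lte_fin; have [c1|c1] := ltP.
    by rewrite -EFinB opprK mulr2n.
  by rewrite (_ : c = 0%R) ?mul0rn//; apply/eqP; rewrite eq_le c0 andbT; lra.
rewrite /= /leb_succ /pushforward.
rewrite (_ : _ @^-1` _ = `[(- c)%R, c]%classic `*`
    [set t | forall i, (`|(tnth t i : R)| <= c)%R]); last first.
  apply/seteqP; split => -[x t] /=.
    move=> h; split; first by have := h ord0; rewrite tnth0 in_itv /= ler_norml.
    by move=> i; have := h (lift ord0 i); rewrite tnthS.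
  move=> [xc tc] i; have [j ->|->] := unliftP ord0 i; first by rewrite tnthS.
  by rewrite tnth0; move: xc; rewrite in_itv /= ler_norml.
rewrite product_measure1E//; last first.
  exact: measurable_cube.
by rewrite exprS EFinM -I1 -IH.
Qed.
End LebesgueAffine.

(** Inversion is continuous off 0, and the single point 0, where the inverse has the default value
    0, is split off. *)
Lemma measurable_invr (R : realType) :
  measurable_fun setT (@GRing.inv R : measurableTypeR R -> measurableTypeR R).
Proof.
have o0 : open [set x : R | x != 0].
  rewrite (_ : mkset _ = ~` [set 0]); first exact/closed_openC/closed_eq.
  by apply/seteqP; split => x /= /eqP.
rewrite (_ : setT = [set x : R | x != 0] `|` [set 0]); last first.
  by apply/seteqP; split => // x _ /=; have [->|] := eqVneq x 0; [right|left].
apply/measurable_funU => //; first exact: open_measurable.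
split.
  apply: open_continuous_measurable_fun => // x /[!inE] /= x0.
  exact: inv_continuous.
exact: measurable_fun_set1.
Qed.

(** * Polar coordinates by averaging ray integrals *)

Section Polar.
Variables (R : realType) (n : nat).
Local Open Scope ereal_scope.
Local Notation mu := (@lebesgue_measure R).
Local Notation row := (@tuple_row R n.+1).
Local Notation tup := (n.+1.-tuple (measurableTypeR R)).
Implicit Types (F G : 'rV[R]_n.+1 -> R) (y : 'rV[R]_n.+1).

Definition row_measurable F := measurable_fun setT (F \o row).

(** For [z != 0] the integral of [wt (r^-1 *: z)] against dr/r over r > 0 equals 1. This
    normalisation lets an average over the whole space stand in for integration over the unit
    sphere. *)
Definition wt y : R := (\1_[set z : 'rV[R]_n.+1 | 1 < `|z|]%R y * `|y|^-1)%R.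

Definition ray F y : \bar R :=
  \int[mu]_r (\1_`]0%R, +oo[ r * r ^+ n * F (r *: y))%:E.

Lemma indic_exp_ge0 (r : R) : (0 <= \1_`]0%R, +oo[ r * r ^+ n)%R.
Proof.
rewrite indicE mem_setE in_itv /= andbT.
by case: (ltP 0%R r) => /= r0; rewrite ?mul0r// mul1r exprn_ge0// ltW.
Qed.

Lemma row_measurable_norm : row_measurable (fun y => `|y|)%R.
Proof. by apply: continuous_measurable_tuple => x; exact: norm_continuous. Qed.

Lemma wt_ge0 y : (0 <= wt y)%R.
Proof. by rewrite mulr_ge0// invr_ge0. Qed.

Lemma row_measurable_wt : row_measurable wt.
Proof.
apply: measurable_funM.
  rewrite (_ : (fun _ => _) = \1_(row @^-1` [set z | (1 < `|z|)%R])); last first.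
    by apply/funext => t; rewrite /= !indicE.
  apply: measurable_indic; apply: measurable_tuple_open.
  apply: (@open_comp _ _ (fun z : 'rV[R]_n.+1 => `|z|%R) [set x : R | (1 < x)%R]).
    by move=> x _; exact: norm_continuous.
  exact: open_gt.
apply: (measurableT_comp (@measurable_invr R)); exact: row_measurable_norm.
Qed.

Lemma measurable_scale_row F : row_measurable F ->
  measurable_fun setT
    (fun p : measurableTypeR R * tup => F ((p.1 : R) *: row p.2)%R).
Proof.
move=> mF; pose s (p : measurableTypeR R * tup) : tup :=
  [tuple ((p.1 : R) * tnth p.2 i)%R | i < n.+1].
have ms : measurable_fun setT s.
  apply/measurable_fun_tnthP => i.
  rewrite (_ : _ \o _ = fun p => ((p.1 : R) * tnth p.2 i)%R); last first.
    by apply/funext => p; rewrite /= tnth_mktuple.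
  apply: measurable_funM => //.
  exact: (measurableT_comp (measurable_tnth i)).
rewrite (_ : (fun _ => _) = (F \o row) \o s); first exact: measurableT_comp.
apply/funext => p /=; congr F; apply/rowP => i.
by rewrite !mxE tnth_mktuple.
Qed.

Definition zero_tuple : tup := [tuple 0%R | i < n.+1].

Lemma row_affine (r : R) (t : tup) : row (affine_tuple r zero_tuple t) = (r *: row t)%R.
Proof. by apply/rowP => i; rewrite !mxE !tnth_mktuple addr0. Qed.

Lemma ge0_integral_scale_row F (r : R) : (0 < r)%R -> row_measurable F ->
  (forall y, 0 <= F y)%R ->
  \int[leb R n.+1]_t (F (r *: row t)%R)%:E =
  (r ^- n.+1)%:E * \int[leb R n.+1]_t (F (row t))%:E.
Proof.
move=> r0 mF F0.
rewrite -(@ge0_integral_leb_affine _ _ (fun t => (F (row t))%:E) r zero_tuple)//.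
- by apply: eq_integral => t _; rewrite row_affine.
- exact/measurable_EFinP.
- by move=> t; rewrite lee_fin.
Qed.

(* With z = r y the left-hand side is the integral over z of
   F z * |z|^-1 * \int_(0 < r < |z|) dr. *)
Lemma polar_integral F : row_measurable F -> (forall y, 0 <= F y)%R ->
  \int[leb R n.+1]_t ((wt (row t))%:E * ray F (row t)) =
  \int[leb R n.+1]_t (F (row t))%:E.
Proof.
move=> mF F0.
have mpos : measurable_fun setT (fun r : measurableTypeR R => \1_`]0%R, +oo[ r : R).
  exact: measurable_indic.
pose H (p : measurableTypeR R * tup) : R :=
  (\1_`]0%R, +oo[ (p.1 : R) * p.1 ^+ n * F ((p.1 : R) *: row p.2) * wt (row p.2))%R.
have H0 p : 0 <= (H p)%:E.
  rewrite lee_fin; apply: mulr_ge0 (wt_ge0 _); apply: mulr_ge0 (F0 _).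
  exact: indic_exp_ge0.
have mH : measurable_fun setT (EFin \o H).
  apply/measurable_EFinP; apply: measurable_funM; last first.
    exact: (measurableT_comp row_measurable_wt).
  apply: measurable_funM; last exact: measurable_scale_row.
  apply: measurable_funM; first exact: (measurableT_comp mpos).
  exact: measurable_funX.
transitivity (\int[leb R n.+1]_t \int[mu]_r (H (r, t))%:E).
  apply: eq_integral => t _; rewrite /ray -ge0_integralZl//.
  - by apply: eq_integral => r _; rewrite -EFinM mulrC.
  - apply/measurable_EFinP; apply: measurable_funM.
      by apply: measurable_funM => //; exact: measurable_funX.
    exact: (measurableT_comp (measurable_scale_row mF) (pair2_measurable t)).
  - by move=> r _; rewrite lee_fin; apply: mulr_ge0 (F0 _); exact: indic_exp_ge0.
  - by rewrite lee_fin wt_ge0.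
rewrite -(fubini_tonelli (EFin \o H) mH H0).
pose K (p : measurableTypeR R * tup) : R :=
  (\1_[set q : measurableTypeR R * tup | (0 < (q.1 : R))%R /\ ((q.1 : R) < `|row q.2|)%R] p *
    (`|row p.2|^-1 * F (row p.2)))%R.
have K0 p : 0 <= (K p)%:E by rewrite lee_fin !mulr_ge0// invr_ge0.
have mK : measurable_fun setT (EFin \o K).
  apply/measurable_EFinP; apply: measurable_funM; last first.
    apply: measurable_funM; last exact: (measurableT_comp mF).
    apply: (measurableT_comp (@measurable_invr R)).
    exact: (measurableT_comp row_measurable_norm).
  apply: measurable_indic; apply: measurableI.
    rewrite -[X in measurable X]setTI.
    apply: (measurable_fst _ [set x : R | (0 < x)%R]) => //.
    by apply: open_measurable; exact: open_gt.
  have mlt : measurable_fun setT (fun q : measurableTypeR R * tup =>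
      ((q.1 : R) < `|row q.2|)%R).
    apply: measurable_fun_ltr => //.
    exact: (measurableT_comp row_measurable_norm).
  by rewrite -[X in measurable X]setTI; apply: (mlt _ [set true]).
transitivity (\int[mu]_r \int[leb R n.+1]_t (K (r, t))%:E).
  apply: eq_integral => r _.
  have [r0|r0] := leP r 0%R.
    rewrite !integral0_eq// => t _; rewrite /K /H /= indicE.
      by rewrite memNset ?mul0r//= => -[]; rewrite ltNge r0.
    by rewrite mem_setE in_itv /= ltNge r0 /= !mul0r.
  (* For fixed [r] the integrand is [G (r *: y)]. The Jacobian [r ^- n.+1], the factor [r ^+ n] and
     the [r] coming out of [wt (r^-1 *: z)] cancel and leave [K]. *)
  pose G y : R := (r ^+ n * wt (r^-1 *: y) * F y)%R.
  have mG : row_measurable G.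
    apply: measurable_funM => //; apply: measurable_funM => //.
    exact: (measurableT_comp (measurable_scale_row row_measurable_wt)
      (pair1_measurable (r^-1)%R)).
  have G0 y : (0 <= G y)%R.
    by rewrite !mulr_ge0 ?wt_ge0// exprn_ge0// ltW.
  transitivity (\int[leb R n.+1]_t (G (r *: row t)%R)%:E).
    apply: eq_integral => t _; rewrite /H /G /= scalerA mulVf ?gt_eqF// scale1r.
    by rewrite indicE mem_setE in_itv /= r0 mul1r; congr EFin; ring.
  rewrite ge0_integral_scale_row// -ge0_integralZl//.
  - apply: eq_integral => t _; rewrite /K /G /wt -EFinM /= !indicE normrZ.
    rewrite gtr0_norm ?invr_gt0//.
    have -> : ((r, t) \in [set q : measurableTypeR R * tup |
        (0 < (q.1 : R))%R /\ ((q.1 : R) < `|row q.2|)%R]) =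
      ((r^-1 *: row t)%R \in [set z : 'rV[R]_n.+1 | (1 < `|z|)%R]).
      apply/idP/idP => /[!inE] /=.
        by move=> [_ ?]; rewrite normrZ gtr0_norm ?invr_gt0// ltr_pdivlMl// mulr1.
      by rewrite normrZ gtr0_norm ?invr_gt0// ltr_pdivlMl// mulr1.
    rewrite invfM invrK exprS; congr EFin.
    have rn0 : (r ^+ n != 0)%R by rewrite expf_neq0// gt_eqF.
    rewrite invfM; have := gt_eqF r0; set b := (_ \in _) => r1.
    have [->|y0] := eqVneq (`|row t|)%R 0%R; first by rewrite invr0; ring.
    by field; rewrite y0 rn0 r1.
  - exact/measurable_EFinP.
  - by move=> t _; rewrite lee_fin.
  - by rewrite lee_fin invr_ge0 exprn_ge0// ltW.
rewrite (fubini_tonelli (EFin \o K) mK K0).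
apply: ge0_ae_eq_integral => //.
- exact: measurable_fun_fubini_tonelli_G.
- exact/measurable_EFinP.
- by move=> t _; apply: integral_ge0 => r _; exact: K0.
- by move=> t _; rewrite lee_fin.
(* The only exceptional point is the origin, where the integral of [K] over [r] is 0 whatever the
   value of [F]; it is the cube of side 0. *)
exists [set t : tup | forall i, (`|(tnth t i : R)| <= 0)%R]; split.
- exact: measurable_cube.
- transitivity ((0 *+ 2 : R)%R ^+ n.+1)%:E; first exact: leb_cube.
  by rewrite mul0rn expr0n.
move=> t /= h i; apply: contrapT => ti; apply: h => _.
have y0 : (0 < `|row t|)%R.
  rewrite normr_gt0; apply/eqP => /rowP /(_ i); rewrite !mxE => ti0.
  by apply: ti; rewrite ti0 normr0.
rewrite /fubini_G /= (eq_integral (fun r : measurableTypeR R => (`|row t|^-1 * F (row t))%:E *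
    (\1_`]0%R, `|row t|%R[ r)%:E)); last first.
  move=> r _; rewrite /K -EFinM mulrC !indicE; congr (_ * _%:R)%:E.
  by congr nat_of_bool; apply/idP/idP => /[!inE] /=; rewrite in_itv /= => /andP.
rewrite ge0_integralZl//.
- transitivity ((`|row t|^-1 * F (row t))%:E * mu `]0%R, `|row t|%R[%classic).
    by rewrite integral_indic// setIT.
  rewrite lebesgue_measure_itv /= lte_fin y0 sube0.
  by rewrite -EFinM mulrAC mulVf ?mul1r// gt_eqF.
- exact/measurable_EFinP/measurable_indic.
- by rewrite lee_fin mulr_ge0// invr_ge0.
Qed.
End Polar.

Lemma continuous_compT (T U V : topologicalType) (f : T -> U) (g : U -> V) :
  continuous f -> continuous g -> continuous (fun x => g (f x)).
Proof. by move=> cf cg x; apply: (@continuous_comp _ _ _ f g); [exact: cf|exact: cg]. Qed.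

(** * Comparison of integrals through their rays *)

Section PolarConsequences.
Variables (R : realType) (n : nat).
Local Open Scope ereal_scope.
Local Notation mu := (@lebesgue_measure R).
Local Notation row := (@tuple_row R n.+1).
Local Notation tup := (n.+1.-tuple (measurableTypeR R)).
Implicit Types (F G q : 'rV[R]_n.+1 -> R) (y : 'rV[R]_n.+1).

Definition row_tuple y : tup := [tuple y ord0 i | i < n.+1].

Lemma row_tupleK y : row (row_tuple y) = y.
Proof. by apply/rowP => i; rewrite mxE tnth_mktuple. Qed.

Lemma ray_ge0 F y : (forall z, 0 <= F z)%R -> 0 <= ray F y.
Proof.
move=> F0; apply: integral_ge0 => r _; rewrite lee_fin.
by apply: mulr_ge0 => //; exact: indic_exp_ge0.
Qed.

Let measurable_ray_integrand F : row_measurable F ->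
  measurable_fun setT (fun p : measurableTypeR R * tup =>
    (\1_`]0%R, +oo[ (p.1 : R) * p.1 ^+ n * F ((p.1 : R) *: row p.2))%R%:E).
Proof.
move=> mF; apply/measurable_EFinP; apply: measurable_funM; last first.
  exact: measurable_scale_row.
apply: measurable_funM; last exact: measurable_funX.
by apply: (@measurableT_comp _ _ _ _ _ _ (\1_`]0%R, +oo[ : R -> R)) => //; exact: measurable_indic.
Qed.

Lemma measurable_ray F : row_measurable F -> (forall y, 0 <= F y)%R ->
  measurable_fun setT (fun t : tup => ray F (row t)).
Proof.
move=> mF F0.
apply: (measurable_fun_fubini_tonelli_G _ (measurable_ray_integrand mF)) => p.
by rewrite lee_fin; apply: mulr_ge0 => //; exact: indic_exp_ge0.
Qed.

(** Homogeneity of degree [- n.+1], by substituting [l * r] for [r]. It makes a ray inequality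
    depend on the direction only and turns a gauge into a scalar factor. *)
Lemma ray_scale F (l : R) y : (0 < l)%R -> row_measurable F ->
  (forall z, 0 <= F z)%R ->
  ray F (l *: y)%R = (l ^- n.+1)%:E * ray F y.
Proof.
move=> l0 mF F0; rewrite /ray.
pose g (r : measurableTypeR R) : \bar R :=
  (\1_`]0%R, +oo[ r * r ^+ n * F (r *: y)%R)%R%:E.
have g0 r : 0 <= g r.
  by rewrite lee_fin; apply: mulr_ge0 => //; exact: indic_exp_ge0.
have mg : measurable_fun setT g.
  rewrite /g -(row_tupleK y).
  exact: (measurableT_comp (measurable_ray_integrand mF) (pair2_measurable _)).
transitivity (\int[mu]_r ((l ^- n)%:E * g (l * r + 0)%R)).
  apply: eq_integral => r _; rewrite /g -EFinM addr0 scalerA (mulrC r l).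
  congr EFin; rewrite [in RHS]indicE [in LHS]indicE !mem_setE !in_itv /= !andbT.
  rewrite pmulr_rgt0//; case: (0 < r)%R; rewrite ?mul0r ?mulr0// !mul1r.
  by rewrite exprMn !mulrA mulVf ?mul1r// expf_neq0// gt_eqF.
rewrite ge0_integralZl//.
- rewrite (ge0_integral_lebesgue_affine _ l0 mg g0) muleA -EFinM -invfM.
  by rewrite -exprSr.
- apply: (measurableT_comp mg); apply: measurable_funD => //.
- by rewrite lee_fin invr_ge0 exprn_ge0// ltW.
Qed.

Let measurable_wtE : measurable_fun setT (fun t : tup => (wt (row t))%:E).
Proof. by apply/measurable_EFinP; exact: row_measurable_wt. Qed.

(** By contraposition: the reverse inequality along every ray would integrate, against [wt], to the
    reverse inequality between the full integrals. The origin contributes nothing because [wt]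
    vanishes there, whence [y != 0]. *)
Lemma ray_lt_of_integral_lt F G (c : R) : (0 <= c)%R ->
  row_measurable F -> row_measurable G ->
  (forall y, 0 <= F y)%R -> (forall y, 0 <= G y)%R ->
  \int[leb R n.+1]_t (G (row t))%:E < c%:E * \int[leb R n.+1]_t (F (row t))%:E ->
  exists2 y, y != 0%R & ray G y < c%:E * ray F y.
Proof.
move=> c0 mF mG F0 G0; apply: contraPP => h; apply/negP; rewrite -leNgt.
rewrite -!polar_integral// -ge0_integralZl//; last 2 first.
  apply: emeasurable_funM; last exact: measurable_ray.
  exact: measurable_wtE.
  by move=> t _; rewrite mule_ge0 ?ray_ge0// lee_fin wt_ge0.
apply: ge0_le_integral => //.
- move=> t _; rewrite !mule_ge0 ?ray_ge0// lee_fin ?wt_ge0//.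
- apply: emeasurable_funM => //; apply: emeasurable_funM; last exact: measurable_ray.
  exact: measurable_wtE.
- apply: emeasurable_funM; last exact: measurable_ray.
  exact: measurable_wtE.
move=> t _; rewrite muleCA; have [t0|t0] := eqVneq (row t) 0%R.
  by rewrite /wt t0 normr0 invr0 mulr0 !mul0e.
rewrite lee_wpmul2l ?lee_fin ?wt_ge0// leNgt; apply/negP => tl.
by apply: h; exists (row t).
Qed.

(* Both integrals are the same multiple of the ray integrals along theta. *)
Lemma integral_gauge_le F G q (c : R) (theta : 'rV[R]_n.+1) : (0 <= c)%R ->
  continuous F -> continuous G -> continuous q ->
  (forall y, 0 <= F y)%R -> (forall y, 0 <= G y)%R ->
  (forall (l : R) y, 0 < l -> q (l *: y) = l * q y)%R ->
  (forall y, y != 0 -> 0 < q y)%R ->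
  ray G theta <= c%:E * ray F theta ->
  \int[leb R n.+1]_t (G (q (row t) *: theta)%R)%:E <=
  c%:E * \int[leb R n.+1]_t (F (q (row t) *: theta)%R)%:E.
Proof.
move=> c0 cF cG cq F0 G0 qZ q0 GF.
have cs (H : 'rV[R]_n.+1 -> R) : continuous H -> continuous (fun y => H (q y *: theta))%R.
  move=> cH; apply: (@continuous_compT _ _ _ (fun y => q y *: theta)%R H) => // y.
  exact: continuousZr_tmp (cq y).
have cFq := cs _ cF; have cGq := cs _ cG.
have mF := continuous_measurable_tuple cFq.
have mG := continuous_measurable_tuple cGq.
(* Since [q (r *: y) = r * q y], the ray of the composite at [y] is the ray of [H] at
   [q y *: theta]; [ray_scale] then extracts a factor that is the same for [F] and [G]. *)
have rq (H : 'rV[R]_n.+1 -> R) y : continuous H -> (forall y, 0 <= H y)%R -> y != 0%R ->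
    ray (fun y => H (q y *: theta))%R y = ((q y) ^- n.+1)%:E * ray H theta.
  move=> cH H0 y0; rewrite -ray_scale//.
  - apply: eq_integral => r _; rewrite !indicE mem_setE in_itv /= andbT.
    by case: (ltP 0%R r) => r0; rewrite ?mul0r// qZ// scalerA.
  - exact: q0.
  - exact: continuous_measurable_tuple.
rewrite -(@polar_integral _ _ (fun y => G (q y *: theta))%R)//.
rewrite -(@polar_integral _ _ (fun y => F (q y *: theta))%R)//.
rewrite -ge0_integralZl//; last 2 first.
  apply: emeasurable_funM; last exact: measurable_ray.
  exact: measurable_wtE.
  by move=> t _; rewrite mule_ge0 ?ray_ge0// lee_fin wt_ge0.
apply: ge0_le_integral => //.
- move=> t _; rewrite !mule_ge0 ?ray_ge0// lee_fin ?wt_ge0//.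
- apply: emeasurable_funM; last exact: measurable_ray.
  exact: measurable_wtE.
- apply: emeasurable_funM => //; apply: emeasurable_funM; last exact: measurable_ray.
  exact: measurable_wtE.
move=> t _; rewrite muleCA; have [t0|t0] := eqVneq (row t) 0%R.
  by rewrite /wt t0 normr0 invr0 mulr0 !mul0e.
rewrite lee_wpmul2l ?lee_fin ?wt_ge0// !rq// muleCA lee_wpmul2l//.
by rewrite lee_fin invr_ge0 exprn_ge0// ltW// q0.
Qed.

Lemma ge0_integral_translate_row F (a : 'rV[R]_n.+1) : row_measurable F ->
  (forall y, 0 <= F y)%R ->
  \int[leb R n.+1]_t (F (row t + a)%R)%:E = \int[leb R n.+1]_t (F (row t))%:E.
Proof.
move=> mF F0; transitivity ((1 ^- n.+1)%:E * \int[leb R n.+1]_t (F (row t))%:E).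
  rewrite -(@ge0_integral_leb_affine _ _ (fun t => (F (row t))%:E) 1%R (row_tuple a))//.
  - apply: eq_integral => t _; congr (F _)%:E; apply/rowP => i.
    by rewrite !mxE !tnth_mktuple mul1r.
  - exact/measurable_EFinP.
  - by move=> t; rewrite lee_fin.
by rewrite expr1n invr1 mul1e.
Qed.

Lemma leb_bounded (c : R) :
  leb R n.+1 [set t | `|row t| <= c]%R < +oo.
Proof.
have [c0|c0] := leP 0%R c; last first.
  rewrite (_ : mkset _ = set0) ?measure0//; apply/seteqP; split => // t /=.
  by apply/negP; rewrite -ltNge (lt_le_trans c0).
rewrite (_ : mkset _ = [set t : tup | forall i, (`|(tnth t i : R)| <= c)%R]).
  by rewrite [X in X < _](leb_cube n.+1 c0) ltry.
apply/seteqP; split => t /= tc.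
  by move=> i; apply: le_trans tc; have := coord_le_norm (row t) i; rewrite mxE.
by apply: norm_rV_le => // i; rewrite mxE.
Qed.

(** By continuity [F] exceeds [F x0 / 2] on a cube around [x0]; translating first puts that cube at
    the origin, where its volume is known. *)
Lemma integral_gt0 F x0 : continuous F -> (forall y, 0 <= F y)%R ->
  F x0 != 0%R -> 0 < \int[leb R n.+1]_t (F (row t))%:E.
Proof.
move=> cF F0 Fx0; have Fp : (0 < F x0)%R by rewrite lt_neqAle eq_sym Fx0 F0.
have mF := continuous_measurable_tuple cF.
rewrite -(ge0_integral_translate_row x0)//.
have cFx : continuous (fun y => F (y + x0)%R).
  apply: (@continuous_compT _ _ _ (fun y => y + x0)%R F) => // y.
  by apply: continuousD; [exact: cvg_id|exact: cst_continuous].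
have /nbhs_ballP[e /= e0 eF] : nbhs (0 : 'rV[R]_n.+1)%R
    ((fun y => F (y + x0)%R) @^-1` [set r : R | (F x0 / 2 < r)%R]).
  apply: cFx; apply: open_nbhs_nbhs; split; first exact: open_gt.
  by rewrite /= add0r ltr_pdivrMr// ltr_pMr// ltr1n.
pose C := [set t : tup | forall i, (`|(tnth t i : R)| <= e / 2)%R].
have mC : measurable C by exact: measurable_cube.
apply: (@lt_le_trans _ _ (\int[leb R n.+1]_t ((F x0 / 2)%:E * (\1_C t)%:E))).
  rewrite ge0_integralZl//; last 2 first.
  - exact/measurable_EFinP/measurable_indic.
  - by rewrite lee_fin divr_ge0.
  rewrite integral_indic// setIT [X in _ * X](leb_cube n.+1); last by rewrite divr_ge0// ltW.
  by rewrite -EFinM lte_fin !(mulr_gt0, divr_gt0)// exprn_gt0// mulrn_wgt0// divr_gt0.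
apply: ge0_le_integral => //.
- by move=> t _; rewrite -EFinM lee_fin mulr_ge0// divr_ge0.
- by apply/measurable_EFinP/measurable_funM => //; exact: measurable_indic.
- by apply/measurable_EFinP; exact: (continuous_measurable_tuple cFx).
move=> t _; rewrite -EFinM lee_fin indicE.
case: (boolP (t \in C)) => [/[!inE] Ct|_]; last by rewrite mulr0.
rewrite mulr1 ltW//; apply: (eF (row t)); rewrite -ball_normE /= sub0r normrN.
rewrite (@le_lt_trans _ _ (e / 2)%R)//; last by rewrite ltr_pdivrMr// ltr_pMr// ltr1n.
by apply: norm_rV_le => [|i]; rewrite ?mxE// divr_ge0// ltW.
Qed.

End PolarConsequences.

(** * Directional derivatives and restriction to lines *)

Section IsDeriveCvg.
Variables (R : realType) (V : normedModType R).
Implicit Types (f : V -> R) (x v w : V).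

Lemma is_derive_cvg f x v (d : R) :
  is_derive x v f d <-> h^-1 *: (f (h *: v + x) - f x) @[h --> (0 : R)^'] --> d.
Proof.
split=> [[df <-]|cv]; first exact: df.
by apply: DeriveDef; [apply/cvg_ex; exists d|exact: cvg_lim].
Qed.

End IsDeriveCvg.

Section Lines.
Variables (R : realType) (V : normedModType R).
Implicit Types (f : V -> R) (x v w : V).

(** Restriction to a line makes the one-variable chain rule and mean value theorem available for
    directional derivatives. *)
Lemma is_derive_at_line f x v (s d : R) :
  is_derive (s *: v + x) v f d <-> is_derive s 1 (fun r : R => f (r *: v + x)) d.
Proof.
have E : (fun h : R => h^-1 *: (f (h *: v + (s *: v + x)) - f (s *: v + x))) =
    (fun h : R => h^-1 *: ((fun r : R => f (r *: v + x)) (h *: 1 + s) -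
      (fun r : R => f (r *: v + x)) s)).
  by apply/funext => h; rewrite scalerDl addrA [h *: 1]mulr1.
split=> /is_derive_cvg fd; apply/is_derive_cvg; first by rewrite E in fd.
by rewrite E.
Qed.

Lemma is_derive_scaledir f x v (c d : R) :
  is_derive x v f d -> is_derive x (c *: v) f (c * d).
Proof.
move=> fd; have : is_derive ((0 : R) *: (c *: v) + x) (c *: v) f (c * d).
  apply/is_derive_at_line.
  rewrite (_ : (fun _ => _) = (fun s : R => f (s *: v + x)) \o ( *%R c)); last first.
    by apply/funext => s /=; rewrite scalerA mulrC.
  have fd' : is_derive (c * 0 : R) 1 (fun s : R => f (s *: v + x)) d.
    by apply/is_derive_at_line; rewrite mulr0 scale0r add0r.
  rewrite mulrC; apply: (@is_derive1_comp R _ ( *%R c) 0 d c fd').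
  have := is_deriveZ c (is_derive_id (0 : R) 1); rewrite [c *: 1]mulr1; exact.
by rewrite scale0r add0r.
Qed.

Lemma mean_value_line f (f' : V -> R) x v :
  (forall y, is_derive y v f (f' y)) ->
  forall h : R, exists2 s : R, 0 <= s <= 1 &
    f (h *: v + x) - f x = h * f' ((s * h) *: v + x).
Proof.
move=> fd h; pose g (s : R) := f (s *: (h *: v) + x).
have gd (s : R) : is_derive s 1 g (h * f' (s *: (h *: v) + x)).
  by apply/is_derive_at_line/is_derive_scaledir.
have [s] := @MVT_segment R g (fun s => h * f' (s *: (h *: v) + x)) 0 1 ler01
  (fun s _ => gd s) (derivable_within_continuous (fun s _ => @ex_derive _ _ _ _ _ _ _ (gd s))).
rewrite in_itv /= subr0 mulr1 /g scale1r scale0r add0r scalerA => s01 ->.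
by exists s.
Qed.

(** The increment is split at [h *: w + x]. Along [v] the mean value theorem evaluates [f'] at a
    point tending to [x], and continuity of [f'] at [x] gives the limit. *)
Lemma is_derive_adddir f (f' : V -> R) x v w (d : R) :
  (forall y, is_derive y v f (f' y)) -> {for x, continuous f'} ->
  is_derive x w f d -> is_derive x (v + w) f (f' x + d).
Proof.
move=> fd cf' /is_derive_cvg fw; apply/is_derive_cvg.
pose A (h : R) := h^-1 *: (f (h *: v + (h *: w + x)) - f (h *: w + x)).
rewrite (_ : (fun _ => _) = A \+ (fun h : R => h^-1 *: (f (h *: w + x) - f x))); last first.
  by apply/funext => h; rewrite /A /= -scalerDr subrKA [h *: (v + w)]scalerDr addrA.
apply: cvgD => //; apply/cvgrPdist_lt => e e0.
have /nbhs_ballP[r /= r0 rf] : nbhs x (f' @^-1` ball (f' x) e).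
  by apply: cf'; exact: nbhsx_ballx.
have m0 : 0 < `|v| + `|w| + 1 by rewrite ltr_wpDl.
near=> h.
have h0 : h != 0 by near: h; exact: nbhs_dnbhs_neq.
have [s /andP[s0 s1] sE] := @mean_value_line f f' (h *: w + x) v fd h.
rewrite /A sE scalerA mulVf// scale1r; apply: rf.
rewrite -ball_normE /= addrA -normrN opprB addrK.
rewrite (le_lt_trans (ler_normD _ _))// !normrZ (ger0_norm s0).
have : `|h| < r / (`|v| + `|w| + 1).
  near: h; apply: dnbhs0_lt; exact: divr_gt0.
rewrite ltr_pdivlMr//; apply: le_lt_trans.
rewrite !mulrDr mulr1 -addrA lerD//; last by rewrite lerDl.
by rewrite ler_wpM2r// ler_piMl.
Unshelve. all: by end_near.
Qed.
End Lines.

Lemma is_derive_comp1 (R : realType) (V : normedModType R) (f : V -> R)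
    (g : R -> R) (x v : V) (d e : R) :
  is_derive x v f d -> is_derive (f x) 1 g e ->
  is_derive x v (fun y => g (f y)) (e * d).
Proof.
move=> fd ge.
have E : (0 : R) *: v + x = x by rewrite scale0r add0r.
have fd0 : is_derive (0 : R) 1 (fun r : R => f (r *: v + x)) d.
  by apply: (iffLR (is_derive_at_line f x v 0 d)); rewrite E.
have ge0 : is_derive (f ((0 : R) *: v + x)) 1 g e by rewrite E.
have := iffRL (is_derive_at_line (fun y => g (f y)) x v 0 (e * d))
  (@is_derive1_comp _ g (fun r : R => f (r *: v + x)) 0 e d ge0 fd0).
by rewrite E.
Qed.

(** * Calculus of functions of class C^k *)

Section Smooth.
Variables (R : realType) (N : nat).
Implicit Types (f g : 'rV[R]_N -> R) (x y v : 'rV[R]_N).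

Lemma is_Ck_continuous k f : is_Ck k setT f -> continuous f.
Proof. by case: k => [|k] [cf _] x; exact: cf. Qed.

Lemma is_Ck_derive k f i x : is_Ck k.+1 setT f ->
  is_derive x (delta_mx ord0 i) f (partial i f x).
Proof. by move=> [_ /(_ i)[df _]]; apply: derivableP; exact: df. Qed.

Lemma is_Ck_partial k f i : is_Ck k.+1 setT f -> is_Ck k setT (partial i f).
Proof. by move=> [_ /(_ i)[]]. Qed.

Lemma is_CkS k f : is_Ck k.+1 setT f -> is_Ck k setT f.
Proof.
elim: k f => [|k IH] f [cf df]; first by [].
by split=> // i; have [dfi /IH] := df i.
Qed.

(** Accepts any formula for the partial derivatives in place of the operator [partial], so that
    inductions on [k] can be run on explicit expressions. *)
Lemma is_Ck_succ k f (f' : 'I_N -> 'rV[R]_N -> R) : continuous f ->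
  (forall i x, is_derive x (delta_mx ord0 i) f (f' i x)) ->
  (forall i, is_Ck k setT (f' i)) -> is_Ck k.+1 setT f.
Proof.
move=> cf df kf; split=> [x _|i]; first exact: cf.
split=> [x _|]; first exact: ex_derive.
rewrite (_ : partial i f = f' i)//; apply/funext => x.
exact: (@derive_val _ _ _ _ _ _ _ (df i x)).
Qed.

Lemma is_Ck_cst k (c : R) : is_Ck k setT (fun _ : 'rV[R]_N => c).
Proof.
elim: k c => [|k IH] c; first by split=> // x _; exact: cst_continuous.
apply: (@is_Ck_succ k _ (fun _ _ => 0)).
- exact: cst_continuous.
- by move=> i; exact: IH.
Qed.

Lemma continuous_add f g : continuous f -> continuous g ->
  continuous (fun x => f x + g x).
Proof. by move=> cf cg x; exact: (continuousD (cf x) (cg x)). Qed.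

Lemma continuous_mul f g : continuous f -> continuous g ->
  continuous (fun x => f x * g x).
Proof. by move=> cf cg x; exact: (continuousM (cf x) (cg x)). Qed.

Lemma continuous_sum n (f : 'I_n -> 'rV[R]_N -> R) :
  (forall i, continuous (f i)) -> continuous (fun x => \sum_(i < n) f i x).
Proof.
elim: n f => [|n IH] f cf.
  rewrite (_ : (fun _ => _) = cst 0); first exact: cst_continuous.
  by apply/funext => x; rewrite big_ord0.
rewrite (_ : (fun _ => _) =
    fun x => \sum_(i < n) f (widen_ord (leqnSn n) i) x + f ord_max x); last first.
  by apply/funext => x; rewrite big_ord_recr.
by apply: continuous_add => //; apply: IH.
Qed.

Lemma is_CkD k f g : is_Ck k setT f -> is_Ck k setT g ->
  is_Ck k setT (fun x => f x + g x).
Proof.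
elim: k f g => [|k IH] f g kf kg.
  split=> // x _; apply: continuous_add; [exact: is_Ck_continuous kf|exact: is_Ck_continuous kg].
apply: (@is_Ck_succ k _ (fun i x => partial i f x + partial i g x)).
- by apply: continuous_add; [exact: is_Ck_continuous kf|exact: is_Ck_continuous kg].
- by move=> i x; exact: (is_deriveD (is_Ck_derive i x kf) (is_Ck_derive i x kg)).
- by move=> i; apply: IH; exact: is_Ck_partial.
Qed.

Lemma is_CkM k f g : is_Ck k setT f -> is_Ck k setT g ->
  is_Ck k setT (fun x => f x * g x).
Proof.
elim: k f g => [|k IH] f g kf kg.
  split=> // x _; apply: continuous_mul; [exact: is_Ck_continuous kf|exact: is_Ck_continuous kg].
apply: (@is_Ck_succ k _ (fun i x => f x * partial i g x + g x * partial i f x)).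
- by apply: continuous_mul; [exact: is_Ck_continuous kf|exact: is_Ck_continuous kg].
- by move=> i x; exact: (is_deriveM (is_Ck_derive i x kf) (is_Ck_derive i x kg)).
- by move=> i; apply: is_CkD; apply: IH; (exact: is_CkS || exact: is_Ck_partial).
Qed.

Lemma is_Ck_sum k n (f : 'I_n -> 'rV[R]_N -> R) :
  (forall i, is_Ck k setT (f i)) -> is_Ck k setT (fun x => \sum_(i < n) f i x).
Proof.
elim: n f => [|n IH] f cf.
  rewrite (_ : (fun _ => _) = cst 0); first exact: is_Ck_cst.
  by apply/funext => x; rewrite big_ord0.
rewrite (_ : (fun _ => _) =
    fun x => \sum_(i < n) f (widen_ord (leqnSn n) i) x + f ord_max x); last first.
  by apply/funext => x; rewrite big_ord_recr.
by apply: is_CkD => //; apply: IH.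
Qed.

Lemma is_derive_coord x v i : is_derive x v (fun y => y ord0 i : R) (v ord0 i).
Proof.
apply/is_derive_cvg.
have : {near (0 : R)^', cst (v ord0 i) =1
    (fun h : R => h^-1 *: ((h *: v + x) ord0 i - x ord0 i))}.
  near=> h; rewrite !mxE addrK [_ *: _]mulrA mulVf ?mul1r//.
  by near: h; exact: nbhs_dnbhs_neq.
by move=> /near_eq_cvg; move=> /cvg_trans; apply; exact: cvg_cst.
Unshelve. all: by end_near. Qed.

Lemma is_Ck_coord k i : is_Ck k setT (fun y : 'rV[R]_N => y ord0 i).
Proof.
case: k => [|k]; first by split=> // x _; exact: coord_continuous.
apply: (@is_Ck_succ k _ (fun j _ => (delta_mx ord0 j : 'rV_N) ord0 i)).
- exact: coord_continuous.
- by move=> j x; exact: is_derive_coord.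
- by move=> j; exact: is_Ck_cst.
Qed.

Lemma is_Ck_expR k f : is_Ck k setT f -> is_Ck k setT (fun x => expR (f x)).
Proof.
have ce (h : 'rV[R]_N -> R) : continuous h -> continuous (fun x => expR (h x)).
  by move=> ch; apply: (@continuous_compT _ _ _ h (@expR R)) => //; exact: continuous_expR.
elim: k f => [|k IH] f kf.
  by split=> // x _; apply: ce; exact: is_Ck_continuous kf.
apply: (@is_Ck_succ k _ (fun i x => expR (f x) * partial i f x)).
- by apply: ce; exact: is_Ck_continuous kf.
- by move=> i x; apply: is_derive_comp1; exact: is_Ck_derive kf.
- by move=> i; apply: is_CkM; [apply: IH; exact: is_CkS|exact: is_Ck_partial].
Qed.

Lemma is_Ck_inv k f : (forall x, f x != 0) -> is_Ck k setT f ->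
  is_Ck k setT (fun x => (f x)^-1).
Proof.
move=> f0 kf; have cf := is_Ck_continuous kf.
have ci : continuous (fun x => (f x)^-1).
  by move=> x; exact: (cvgV (f0 x) (cf x)).
elim: k kf => [|k IH] kf; first by split=> // x _; exact: ci.
apply: (@is_Ck_succ k _ (fun i x => - 1 * ((f x)^-1 * (f x)^-1) * partial i f x)) => //.
- move=> i x; apply: (is_derive_comp1 (is_Ck_derive i x kf)).
  have := @is_deriveV R id (f x) 1 1 (f0 x) (is_derive_id (f x) 1).
  by rewrite mulN1r -invfM -expr2 [_ *: 1]mulr1.
- move=> i; have ki := IH (is_CkS kf).
  by apply: is_CkM (is_Ck_partial _ kf); apply: is_CkM; [exact: is_Ck_cst|exact: is_CkM].
Qed.

Lemma is_Ck_ln k f : (forall x, 0 < f x) -> is_Ck k setT f ->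
  is_Ck k setT (fun x => ln (f x)).
Proof.
move=> f0 kf; have cf := is_Ck_continuous kf.
have ci : continuous (fun x => ln (f x)).
  move=> x; apply: (@continuous_comp _ _ _ f (@ln R)); first exact: cf.
  exact: continuous_ln.
elim: k kf => [|k IH] kf; first by split=> // x _; exact: ci.
apply: (@is_Ck_succ k _ (fun i x => (f x)^-1 * partial i f x)) => //.
- move=> i x; apply: is_derive_comp1; first exact: is_Ck_derive kf.
  exact: is_derive1_ln.
- move=> i; apply: is_CkM (is_Ck_partial _ kf).
  by apply: is_Ck_inv (is_CkS kf) => x; rewrite gt_eqF.
Qed.

(** Coordinate directions are added one by one with [is_derive_adddir], continuity of the partial
    derivatives being its hypothesis. *)
Lemma is_derive_partials f x v : is_Ck 1 setT f ->
  is_derive x v f (\sum_i v ord0 i * partial i f x).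
Proof.
move=> kf.
have H (r : seq 'I_N) : forall x, is_derive x (\sum_(i <- r) v ord0 i *: delta_mx ord0 i)
    f (\sum_(i <- r) v ord0 i * partial i f x).
  elim: r => [|i r IH] y; first by rewrite !big_nil; exact: is_derive0.
  rewrite !big_cons; apply: (@is_derive_adddir _ _ f (fun y => v ord0 i * partial i f y)).
  - by move=> z; apply: is_derive_scaledir; exact: is_Ck_derive kf.
  - apply: continuous_mul; first exact: cst_continuous.
    exact: (is_Ck_continuous (is_Ck_partial i kf)).
by rewrite {1}[v]matrix_sum_delta big_ord1.
Qed.

(** Differentiating replaces [f] by its partial derivatives but keeps [g] inside, so the induction
    on [k] asks [f] to be smooth of every order and [g] of order [k] only. *)
Lemma is_Ck_comp_line k f g (theta : 'rV[R]_N) :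
  (forall k, is_Ck k setT f) -> is_Ck k setT g ->
  is_Ck k setT (fun x => f (g x *: theta)).
Proof.
elim: k f => [|k IH] f kf kg; have cg := is_Ck_continuous kg.
all: have cfg : continuous (fun x => f (g x *: theta)) by
  apply: (@continuous_compT _ _ _ (fun x => g x *: theta) f);
  [move=> x; exact: continuousZr_tmp (cg x)|exact: is_Ck_continuous (kf 0)].
  by split=> // x _; exact: cfg.
apply: (@is_Ck_succ k _
  (fun i x => (\sum_j theta ord0 j * partial j f (g x *: theta)) * partial i g x)) => //.
- move=> i x; apply: (@is_derive_comp1 _ _ g (fun s : R => f (s *: theta))).
    exact: is_Ck_derive kg.
  have := is_derive_partials (g x *: theta) theta (kf 1%N).
  rewrite -{1}[g x *: theta]addr0 => /is_derive_at_line.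
  by under eq_fun do rewrite addr0.
- move=> i; apply: is_CkM (is_Ck_partial _ kg).
  apply: is_Ck_sum => j; apply: is_CkM; first exact: is_Ck_cst.
  apply: (IH (partial j f)); last exact: is_CkS.
  by move=> l; exact: is_Ck_partial.
Qed.

Lemma partial_comp_line f g (theta : 'rV[R]_N) i x :
  is_Ck 1 setT f -> is_Ck 1 setT g ->
  partial i (fun x => f (g x *: theta)) x =
  dot theta (gradient f (g x *: theta)) * partial i g x.
Proof.
move=> kf kg; apply: derive_val.
apply: (@is_derive_comp1 _ _ g (fun s : R => f (s *: theta))).
  exact: is_Ck_derive kg.
have := is_derive_partials (g x *: theta) theta kf.
rewrite -{1}[g x *: theta]addr0 => /is_derive_at_line.
under eq_fun do rewrite addr0.
rewrite (_ : \sum_j _ = dot theta (gradient f (g x *: theta)))//.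
by apply: eq_bigr => j _; rewrite mxE.
Qed.
End Smooth.

(** * Log-sum-exp smoothing of a maximum of affine forms *)

Section LogSumExp.
Variables (R : realType) (N m : nat).
Variables (xi : 'I_m -> 'rV[R]_N) (b : 'I_m -> R).
Implicit Types (x y v : 'rV[R]_N).

Definition affine_form j x : R := dot (xi j) x + b j.

Definition max_form x : R := \big[maxr/0]_(j < m) affine_form j x.

(** The summand 1 is the exponential of the zero form and matches the initial value 0 in [max_form]:
    what is smoothed is the maximum of 0 and the affine forms. *)
Definition lse (k : R) x : R :=
  k^-1 * ln (1 + \sum_(j < m) expR (k * affine_form j x)).

(** Softmax weights; the mass missing from 1 is the weight of the zero form. *)
Definition lse_weight (k : R) j x : R :=
  expR (k * affine_form j x) / (1 + \sum_(j < m) expR (k * affine_form j x)).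

Let den_gt0 k x : 0 < 1 + \sum_(j < m) expR (k * affine_form j x) :> R.
Proof. by rewrite ltr_pwDl// sumr_ge0// => j _; exact: expR_ge0. Qed.

Lemma lse_weight_ge0 k j x : 0 <= lse_weight k j x.
Proof. by rewrite divr_ge0 ?expR_ge0// ltW. Qed.

Lemma lse_weight_sum k x : \sum_j lse_weight k j x <= 1.
Proof. by rewrite -mulr_suml ler_pdivrMr// mul1r lerDr. Qed.

Lemma is_Ck_affine_form k j : is_Ck k setT (affine_form j).
Proof.
apply: is_CkD; last exact: is_Ck_cst.
apply: is_Ck_sum => i; apply: is_CkM; [exact: is_Ck_cst|exact: is_Ck_coord].
Qed.

Let is_Ck_den k l :
  is_Ck l setT (fun x => 1 + \sum_(j < m) expR (k * affine_form j x)).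
Proof.
apply: is_CkD; first exact: is_Ck_cst.
apply: is_Ck_sum => j; apply: is_Ck_expR; apply: is_CkM; first exact: is_Ck_cst.
exact: is_Ck_affine_form.
Qed.

Lemma is_Ck_lse k l : is_Ck l setT (lse k).
Proof.
by apply: is_CkM; [exact: is_Ck_cst|exact: is_Ck_ln].
Qed.

Lemma is_derive_affine_form j x v : is_derive x v (affine_form j) (dot (xi j) v).
Proof.
have := is_derive_partials x v (is_Ck_affine_form 1 j).
rewrite (_ : \sum_i _ = dot (xi j) v)//; apply: eq_bigr => i _; rewrite mulrC.
congr (_ * _); apply/(@derive_val _ _ _ _ _ _ _ _)/is_derive_cvg.
have : {near (0 : R)^', cst (xi j ord0 i) =1 (fun h : R => h^-1 *:
    (affine_form j (h *: delta_mx ord0 i + x) - affine_form j x))}.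
  near=> h; rewrite /affine_form addrAC opprD addrA addrAC addrK /=.
  rewrite /dot -sumrB (bigD1 i)//= big1 => [|l /negPf li].
    rewrite !mxE !eqxx mulr1 addr0 -mulrBr addrK [_ *: _]mulrCA mulVf ?mulr1//.
    by near: h; exact: nbhs_dnbhs_neq.
  by rewrite !mxE li mulr0 add0r subrr.
by move=> /near_eq_cvg; move=> /cvg_trans; apply; exact: cvg_cst.
Unshelve. all: by end_near. Qed.

(** The gradient is a sub-convex combination of the [xi j]. Hence a bound [dot (xi j) y <= c] with
    [c >= 0], valid for all [j], passes to it uniformly in [k] and [x]. *)
Lemma partial_lse k i x : k != 0 ->
  partial i (lse k) x = \sum_j lse_weight k j x * xi j ord0 i.
Proof.
move=> k0; apply: derive_val.
have dj j : is_derive x (delta_mx ord0 i) (fun y => expR (k * affine_form j y))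
    (expR (k * affine_form j x) * (k * xi j ord0 i)).
  have -> : xi j ord0 i = dot (xi j) (delta_mx ord0 i).
    rewrite /dot (bigD1 i)//= big1 ?addr0 => [|l /negPf li]; last first.
      by rewrite mxE li andbF mulr0.
    by rewrite mxE !eqxx mulr1.
  apply: (@is_derive_comp1 _ _ (fun y => k * affine_form j y) (@expR R)).
  exact: (is_deriveZ k (is_derive_affine_form j x _)).
have ds : is_derive x (delta_mx ord0 i)
    (fun y => 1 + \sum_(j < m) expR (k * affine_form j y))
    (0 + \sum_(j < m) expR (k * affine_form j x) * (k * xi j ord0 i)).
  have := is_deriveD (is_derive_cst (1 : R) x (delta_mx ord0 i)) (is_derive_sum dj).
  by congr is_derive; apply/funext => y /=; rewrite fct_sumE.
have := is_deriveZ k^-1 (is_derive_comp1 ds (is_derive1_ln (den_gt0 k x))).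
congr is_derive; rewrite add0r [_ *: _]mulrA mulr_sumr; apply: eq_bigr => j _.
by rewrite /lse_weight; field; rewrite k0 gt_eqF.
Qed.

Lemma le_affine_max j x : affine_form j x <= max_form x.
Proof. exact: le_bigmax. Qed.

Lemma max_form_ge0 x : 0 <= max_form x.
Proof. exact: bigmax_ge_id. Qed.

Lemma max_form_cases x : max_form x = 0 \/ exists j, max_form x = affine_form j x.
Proof.
rewrite /max_form; elim/big_ind: _ => [|u w [->|[i ->]] [->|[j ->]]|j _].
- by left.
- by left; rewrite maxxx.
- by case: (leP 0 (affine_form j x)) => _; [right; exists j|left].
- by case: (leP (affine_form i x) 0) => _; [left|right; exists i].
- by case: leP => _; [right; exists j|right; exists i].
- by right; exists j.
Qed.

(** One term of the sum already accounts for the maximum. Approximation from above matters: a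
    sublevel set of [lse] lies in the corresponding sublevel set of [max_form], which confines
    supports. *)
Lemma lse_ge_max k x : 0 < k -> max_form x <= lse k x.
Proof.
move=> k0; rewrite ler_pdivlMl//.
have [->|[j ->]] := max_form_cases x.
  by rewrite mulr0 ln_ge0// lerDl sumr_ge0// => j _; exact: expR_ge0.
rewrite -[leLHS]expRK ler_ln ?posrE ?expR_gt0//.
rewrite (bigD1 j)//= addrCA lerDl addr_ge0// sumr_ge0// => i _; exact: expR_ge0.
Qed.

(** The logarithm contains [m.+1] terms, the zero form included, each at most
    [expR (k * max_form x)]. *)
Lemma lse_le_max k x : 0 < k -> lse k x <= max_form x + k^-1 * ln (m.+1%:R).
Proof.
move=> k0; rewrite -[max_form x](mulKf (lt0r_neq0 k0)) -mulrDr ler_pM2l ?invr_gt0//.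
rewrite -[k * _]expRK -lnM ?posrE ?expR_gt0 ?ltr0n// ler_ln ?posrE//; last first.
  by rewrite mulr_gt0 ?expR_gt0 ?ltr0n.
rewrite -natr1 mulrDr mulr1 addrC lerD//.
  rewrite (@le_trans _ _ (\sum_(j < m) expR (k * max_form x)))//.
    by apply: ler_sum => j _; rewrite ler_expR ler_pM2l// le_affine_max.
  by rewrite sumr_const card_ord mulr_natr.
by rewrite -expR0 ler_expR mulr_ge0 ?max_form_ge0// ltW.
Qed.

Lemma cvg_lse x : lse i.+1%:R x @[i --> \oo] --> max_form x.
Proof.
apply: (@squeeze_cvgr _ _ _ _ (fun=> max_form x)
  (fun i : nat => max_form x + i.+1%:R^-1 * ln (m.+1%:R))).
- by near=> i; rewrite lse_ge_max//= lse_le_max.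
- exact: cvg_cst.
- rewrite -[X in _ --> X]addr0 -(mul0r (ln m.+1%:R)).
  apply: cvgD; first exact: cvg_cst.
  by apply: cvgMl; exact: cvg_harmonic.
Unshelve. all: by end_near. Qed.

Lemma continuous_max_form : continuous max_form.
Proof.
rewrite /max_form; elim: (index_enum _) => [|j r IH].
  by under [X in continuous X]funext do rewrite big_nil; exact: cst_continuous.
under [X in continuous X]funext do rewrite big_cons.
move=> x; apply: continuous_max; last exact: IH.
exact: (is_Ck_continuous (is_Ck_affine_form 0 j)).
Qed.
End LogSumExp.

(** * The Euclidean inner product *)

Section Dot.
Variables (R : realType) (N : nat).
Implicit Types (x y z : 'rV[R]_N) (r : R).

Lemma dotC x y : dot x y = dot y x.
Proof. by apply: eq_bigr => i _; rewrite mulrC. Qed.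

Lemma dotDr x y z : dot x (y + z) = dot x y + dot x z.
Proof. by rewrite -big_split; apply: eq_bigr => i _; rewrite mxE mulrDr. Qed.

Lemma dotZr r x y : dot x (r *: y) = r * dot x y.
Proof. by rewrite mulr_sumr; apply: eq_bigr => i _; rewrite mxE mulrCA. Qed.

Lemma dotNr x y : dot x (- y) = - dot x y.
Proof. by rewrite -scaleN1r dotZr mulN1r. Qed.

Lemma dotBr x y z : dot x (y - z) = dot x y - dot x z.
Proof. by rewrite dotDr dotNr. Qed.

Lemma dotDl x y z : dot (y + z) x = dot y x + dot z x.
Proof. by rewrite dotC dotDr !(dotC x). Qed.

Lemma dotZl r x y : dot (r *: x) y = r * dot x y.
Proof. by rewrite dotC dotZr dotC. Qed.

Lemma dotBl x y z : dot (y - z) x = dot y x - dot z x.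
Proof. by rewrite dotC dotBr !(dotC x). Qed.

Lemma dot_sub_sqr r x y :
  dot (x - r *: y) (x - r *: y) = dot x x - 2 * (r * dot x y) + r * (r * dot y y).
Proof. by rewrite dotBl !dotBr !dotZl !dotZr (dotC y x); ring. Qed.

Lemma dot_suml (I : Type) (s : seq I) (a : I -> R) (xi : I -> 'rV[R]_N) x :
  dot (\sum_(i <- s) a i *: xi i) x = \sum_(i <- s) a i * dot (xi i) x.
Proof.
elim: s => [|i s IH].
  by rewrite !big_nil /dot big1// => i _; rewrite mxE mul0r.
by rewrite !big_cons dotDl dotZl IH.
Qed.

Lemma dot_ge0 x : 0 <= dot x x.
Proof. by apply: sumr_ge0 => i _; rewrite -expr2 sqr_ge0. Qed.

Lemma dot_gt0 x : x != 0 -> 0 < dot x x.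
Proof.
move=> x0; rewrite lt_neqAle dot_ge0 andbT eq_sym; apply: contra x0.
rewrite psumr_eq0; last by move=> i _; rewrite -expr2 sqr_ge0.
move=> /allP h; apply/eqP/rowP => i; rewrite mxE; apply/eqP.
by have := h i (mem_index_enum i); rewrite -expr2 sqrf_eq0.
Qed.

Lemma dot_continuous x : continuous (dot x).
Proof.
apply: continuous_sum => i; apply: continuous_mul; first exact: cst_continuous.
exact: coord_continuous.
Qed.
End Dot.

(** * Separation, interiors and polytope approximation of convex bodies *)

Section ConvexGeometry.
Variables (R : realType) (N : nat).
Implicit Types (x y z : 'rV[R]_N) (K : set 'rV[R]_N).

Local Notation cvx K := (convex_set (K : set (convex_lmodType 'rV[R]_N))).

Lemma convex_setP K x y (t : R) : cvx K -> K x -> K y -> 0 <= t <= 1 ->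
  K (t *: x + (1 - t) *: y).
Proof.
move=> cK Kx Ky /andP[t0 t1].
have := cK x y (Itv01 t0 t1) (mem_set Kx) (mem_set Ky).
by rewrite inE.
Qed.

(** Projection onto a convex set: with [y0] the point of [K] nearest to [z], the form given by
    [z - y0] is maximal over [K] at [y0]. The origin in [K] makes that maximum nonnegative, which
    allows the bound to be normalised to 1. *)
Lemma convex_separation K z : compact K -> cvx K -> K 0 -> ~ K z ->
  exists2 xi, (forall y, K y -> dot xi y <= 1) & 1 < dot xi z.
Proof.
move=> cK vK K0 Kz.
have cd : continuous (fun y => dot (z - y) (z - y)).
  rewrite (_ : (fun _ => _) = (fun y => dot z z + (-2) * dot z y + dot y y)); last first.
    by apply/funext => y; rewrite dotBr !dotBl (dotC y z); ring.
  apply: continuous_add; first apply: continuous_add; first exact: cst_continuous.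
    apply: continuous_mul; [exact: cst_continuous|exact: dot_continuous].
  by apply: continuous_sum => i; apply: continuous_mul; exact: coord_continuous.
have [y0 /set_mem Ky0 ymin] :=
  EVT_min_rV (ex_intro _ 0 K0) cK (continuous_subspaceT cd).
set w := z - y0.
have w0 : 0 < dot w w.
  by apply: dot_gt0; rewrite subr_eq0; apply/eqP => zy; apply: Kz; rewrite zy.
have wK y : K y -> dot w y <= dot w y0.
  move=> Ky; rewrite -subr_le0 -dotBr leNgt; apply/negP => d0.
  set d := dot w (y - y0) in d0; set q := dot (y - y0) (y - y0).
  have q0 : 0 <= q := dot_ge0 _.
  (* Moving from [y0] towards [y] by [s] changes the squared distance to [z] by
     [- 2 * s * d + s * s * q], which is negative when [s * (q + 1) <= d]; the [+ 1] keeps the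
     denominator positive. *)
  pose s : R := minr 1 (d / (q + 1)).
  have dq : 0 < d / (q + 1) by rewrite divr_gt0// ltr_wpDl.
  have s0 : 0 < s by rewrite lt_min ltr01.
  have s1 : s <= 1 by rewrite ge_min lexx.
  have Ks : K (s *: y + (1 - s) *: y0) by apply: convex_setP => //; rewrite ltW.
  have := ymin _ (mem_set Ks).
  have -> : z - (s *: y + (1 - s) *: y0) = w - s *: (y - y0).
    by apply/rowP => i; rewrite !mxE; ring.
  rewrite -/w dot_sub_sqr -/d -/q.
  have sq : s * (q + 1) <= d by rewrite -ler_pdivlMr ?ltr_wpDl// ge_min lexx orbT.
  have : 0 < s * d by rewrite mulr_gt0.
  have : s * (s * (q + 1)) <= s * d by rewrite ler_pM2l.
  have : 0 < s * s by rewrite mulr_gt0.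
  rewrite !mulrDr !mulr1 => h1 h2 h3 h4; lra.
have m0 : 0 <= dot w y0 by have := wK 0 K0; rewrite -(scale0r (0 : 'rV_N)) dotZr mul0r.
have mz : dot w z = dot w y0 + dot w w by rewrite -dotDr addrC subrK.
set m := dot w y0 in wK m0 mz.
have p0 : 0 < m + dot w w / 2 by rewrite ltr_wpDl// divr_gt0.
(* The level halfway between [m], the maximum over [K], and [m + dot w w], the value at [z], is
   scaled to 1. *)
exists ((m + dot w w / 2)^-1 *: w) => [y Ky|]; rewrite dotZl.
  by rewrite ler_pdivrMl// mulr1 (le_trans (wK _ Ky))// lerDl divr_ge0// ltW.
by rewrite ltr_pdivlMl// mulr1 mz ltrD2l ltr_pdivrMr// ltr_pMr// ltr1n.
Qed.

Lemma compact_norm_bound K : compact K ->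
  exists2 M : R, 0 < M & forall y, K y -> `|y| <= M.
Proof.
move=> /compact_bounded[M [_ MK]]; exists (`|M| + 1); first by rewrite ltr_wpDl.
by move=> y; apply: MK; rewrite (le_lt_trans (ler_norm _))// ltrDl.
Qed.

Lemma interiorP K x : K° x <-> exists2 e : R, 0 < e & forall y, `|y - x| < e -> K y.
Proof.
split=> [/nbhs_ballP[e /= e0 eK]|[e e0 eK]].
  by exists e => // y yx; apply: eK; rewrite -ball_normE /= distrC.
apply/nbhs_ballP; exists e => // y; rewrite -ball_normE /= distrC; exact: eK.
Qed.

(** A small [y] is the midpoint of [y + x] and [y - x]; with [x] an interior point, the first is in
    [K] directly and the second by symmetry. *)
Lemma symmetric_interior0 K : cvx K -> origin_symmetric K -> K° !=set0 -> K° 0.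
Proof.
move=> vK sK [x /interiorP[e e0 eK]]; apply/interiorP; exists e => // y.
rewrite subr0 => ye.
have K1 : K (y + x) by apply: eK; rewrite addrK.
have K2 : K (y - x).
  by rewrite -opprB; apply: sK; apply: eK; rewrite addrAC subrr sub0r normrN.
have h : 0 <= (2^-1 : R) <= 1 by rewrite invr_ge0 ler0n invf_le1 ?ler1n.
have := convex_setP vK K1 K2 h.
have -> : 1 - 2^-1 = 2^-1 :> R by field.
have -> // : 2^-1 *: (y + x) + 2^-1 *: (y - x) = y.
by apply/rowP => i; rewrite !mxE; field.
Qed.

Lemma scale_interior K y (r : R) : cvx K -> K° 0 -> K y -> 0 <= r < 1 -> K° (r *: y).
Proof.
move=> vK /interiorP[e e0 eK] Ky /andP[r0 r1].
have r1' : 0 < 1 - r by rewrite subr_gt0.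
apply/interiorP; exists ((1 - r) * e); first by rewrite mulr_gt0.
move=> w wy; have Ku : K ((1 - r)^-1 *: (w - r *: y)).
  apply: eK; rewrite subr0 normrZ gtr0_norm ?invr_gt0// ltr_pdivrMl//.
have h : 0 <= r <= 1 by rewrite r0 ltW.
by have := convex_setP vK Ky Ku h; rewrite scalerA divff ?gt_eqF// scale1r addrC subrK.
Qed.

(** Points outside [K°] are cut off by open half-spaces [r < dot xi z] with [xi] in the polar body;
    compactness of the bounded set [C] of such points leaves finitely many of them. *)
Lemma polytope_inside K (r : R) : compact K -> cvx K -> K° 0 -> 0 < r < 1 ->
  exists m (xi : 'I_m -> 'rV[R]_N), (forall j y, K y -> dot (xi j) y <= 1) /\
    forall z, max_form xi (fun=> 0) z <= r -> K° z.
Proof.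
move=> cK vK i0 /andP[r0 r1]; have K0 : K 0 by exact: interior_subset.
have [M M0 MK] := compact_norm_bound cK.
pose C := [set z : 'rV[R]_N | ~ K° z /\ `|z| <= M + 1].
have cC : compact C.
  apply: bounded_closed_compact.
    exists (M + 1); split; first exact: num_real.
    by move=> x Mx y [_ /le_trans]; apply; exact: ltW.
  apply: closedI; first exact/open_closedC/open_interior.
  apply: (@closed_comp _ _ (fun z : 'rV[R]_N => `|z|) [set x : R | x <= M + 1]).
    by move=> x _; exact: norm_continuous.
  exact: closed_le.
move: (cC); rewrite compact_cover => /(_ 'rV[R]_N [set xi | forall y, K y -> dot xi y <= 1]
  (fun xi => [set z | r < dot xi z])) [].
- move=> xi _; apply: (@open_comp _ _ (dot xi) [set x : R | r < x]).
    by move=> x _; exact: dot_continuous.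
  exact: open_gt.
(* Scaling by [r^-1] pushes [z] out of [K] itself, where separation applies; scaling back lowers the
   level from 1 to [r]. *)
- move=> z [Kz _]; have : ~ K (r^-1 *: z).
    move=> Krz; apply: Kz; have h : 0 <= r < 1 by rewrite ltW.
    by have := scale_interior vK i0 Krz h; rewrite scalerA divff ?gt_eqF// scale1r.
  move=> /(convex_separation cK vK K0)[xi xiK xiz]; exists xi => //.
  by move: xiz; rewrite dotZr /= ltr_pdivlMl// mulr1.
move=> D DK CD; pose s := enum_fset D.
have sD j : (tnth (in_tuple s) j) \in D by exact: mem_tnth.
exists (size s), (fun j => tnth (in_tuple s) j); split=> [j y Ky|z].
  by have := DK _ (sD j); rewrite inE => /(_ _ Ky).
apply: contraPP => Kz; apply/negP; rewrite -ltNge.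
have CP w : C w -> r < max_form (fun j => tnth (in_tuple s) j) (fun=> 0) w.
  move=> /CD[xi /= Dxi rxi]; apply: (lt_le_trans rxi).
  have /tnthP[j xij] : xi \in in_tuple s by [].
  rewrite xij; have := le_affine_max (fun j => tnth (in_tuple s) j) (fun=> 0) j w.
  by rewrite /affine_form addr0.
have [zM|zM] := leP `|z| (M + 1); first exact: CP.
have z0 : 0 < `|z| by rewrite (lt_trans _ zM)// addr_gt0.
(* A far point is pulled back to norm [M + 1], still outside [K]; the factor [l < 1] cannot increase
   [max_form]. *)
pose l := (M + 1) / `|z|.
have l0 : 0 < l by rewrite divr_gt0// addr_gt0.
have l1 : l < 1 by rewrite ltr_pdivrMr// mul1r.
have : C (l *: z).
  have lz : `|l *: z| = M + 1.
    by rewrite normrZ gtr0_norm// mulfVK// gt_eqF.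
  split; last by rewrite lz.
  by move=> /interior_subset/MK; rewrite lz leNgt ltrDl ltr01.
move=> /CP/lt_le_trans; apply.
have [->|[j ->]] := max_form_cases (fun j => tnth (in_tuple s) j) (fun=> 0) (l *: z).
  exact: max_form_ge0.
have [h|h] := leP (dot (tnth (in_tuple s) j) z) 0.
  rewrite /affine_form addr0 dotZr (le_trans _ (max_form_ge0 _ _ _))//.
  by rewrite pmulr_rle0.
rewrite /affine_form addr0 dotZr.
apply: (@le_trans _ _ (dot (tnth (in_tuple s) j) z)); first by rewrite ler_piMl// ltW.
by have := le_affine_max (fun j => tnth (in_tuple s) j) (fun=> 0) j z; rewrite /affine_form addr0.
Qed.
End ConvexGeometry.

Lemma continuous_shift (R : realType) N (f : 'rV[R]_N -> R) (a : 'rV[R]_N) :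
  continuous f -> continuous (fun x : 'rV[R]_N => f (x + a)).
Proof.
move=> cf x; have ca : (y + a) @[y --> x] --> x + a.
  by apply: continuousD; [exact: cvg_id|exact: cst_continuous].
exact: (cvg_comp _ _ ca (cf (x + a))).
Qed.

(** * Integrals of functions that vanish outside a bounded set *)

Section BoundedSupport.
Variables (R : realType) (n : nat).
Local Open Scope ereal_scope.
Local Notation row := (@tuple_row R n.+1).
Local Notation tup := (n.+1.-tuple (measurableTypeR R)).
Local Notation mu := (leb R n.+1).
Local Notation I f := (\int[leb R n.+1]_t (f (tuple_row t))%:E).
Implicit Types (f g : 'rV[R]_n.+1 -> R) (x y : 'rV[R]_n.+1).

Definition vanishes_beyond (c : R) f := forall x, (c < `|x|)%R -> f x = 0%R.

Lemma eint_vanishing U f : (forall x, ~ U x -> f x = 0%R) -> eint U f = I f.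
Proof.
move=> f0; rewrite /eint integral_mkcond; apply: eq_integral => t _.
by rewrite /patch; case: ifPn => // /negP tU; rewrite f0// => Ut; apply: tU; rewrite inE.
Qed.

Lemma integrable_vanishing c (M : R) f : row_measurable f -> vanishes_beyond c f ->
  (forall x, `|f x| <= M)%R -> mu.-integrable setT (fun t => (f (row t))%:E).
Proof.
move=> mf fc fM; pose B := [set t : tup | (`|row t| <= c)%R].
have mB : measurable B.
  rewrite -[X in measurable X]setTI.
  have := @row_measurable_norm R n; rewrite /row_measurable => mn.
  rewrite (_ : B = (fun t : tup => `|row t|)%R @^-1` `]-oo, c]%classic).
    exact: mn.
  by apply/seteqP; split => t; rewrite /B /= in_itv.
have M0 : (0 <= M)%R by rewrite (le_trans _ (fM 0%R)).
apply: (@le_integrable _ _ _ _ _ _ _ (fun t => (M * \1_B t)%:E)) => //.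
- exact/measurable_EFinP.
- move=> t _ /=; rewrite lee_fin indicE; have [tc|tc] := leP (`|row t|)%R c.
    by rewrite mem_set// mulr1 (ger0_norm M0).
  by rewrite (fc _ tc) normr0.
apply/integrableP; split.
  by apply/measurable_EFinP/measurable_funM => //; exact: measurable_indic.
rewrite (eq_integral (fun t => M%:E * (\1_B t)%:E)); last first.
  by move=> t _; rewrite -EFinM gee0_abs// lee_fin mulr_ge0.
rewrite ge0_integralZl//; last exact/measurable_EFinP/measurable_indic.
rewrite integral_indic// setIT lte_mul_pinfty//; exact: leb_bounded.
Qed.

Lemma vanishing_bounded c f : continuous f -> vanishes_beyond c f ->
  exists M : R, forall x, (`|f x| <= M)%R.
Proof.
move=> cf fc.
pose C := [set x : 'rV[R]_n.+1 | (`|x| <= maxr c 0)%R].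
have cC : compact C.
  apply: bounded_closed_compact.
    exists (maxr c 0)%R; split; first exact: num_real.
    by move=> x Mx y /le_trans; apply; exact: ltW.
  apply: (@closed_comp _ _ (fun z : 'rV[R]_n.+1 => `|z|)%R [set x : R | (x <= maxr c 0)%R]).
    by move=> x _; exact: norm_continuous.
  exact: closed_le.
have C0 : C 0%R by rewrite /C /= normr0 le_max lexx orbT.
have cnf : continuous (fun x => `|f x|%R).
  by apply: (@continuous_compT _ _ _ f (fun r : R => `|r|)%R) => // x; exact: norm_continuous.
have [x0 _ x0max] := EVT_max_rV (ex_intro _ _ C0) cC (continuous_subspaceT cnf).
exists `|f x0|%R => x; have [xC|xC] := leP (`|x|)%R (maxr c 0)%R.
  by apply: x0max; rewrite inE.
by rewrite fc ?normr0// (le_lt_trans _ xC)// le_max lexx.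
Qed.

Lemma integrable_continuous c f : continuous f -> vanishes_beyond c f ->
  mu.-integrable setT (fun t => (f (row t))%:E).
Proof.
move=> cf fc; have [M fM] := vanishing_bounded cf fc.
exact: (integrable_vanishing (continuous_measurable_tuple cf) fc fM).
Qed.

Lemma cvg_integral_vanishing c (M : R) (f_ : nat -> 'rV[R]_n.+1 -> R) f :
  (forall k, row_measurable (f_ k)) -> (forall k, vanishes_beyond c (f_ k)) ->
  (forall k x, `|f_ k x| <= M)%R ->
  (forall x, (f_ k x @[k --> \oo] --> f x)%R) ->
  I (f_ k) @[k --> \oo] --> I f.
Proof.
move=> mf fc fM ff; pose B := [set x : 'rV[R]_n.+1 | (`|x| <= c)%R].
have M0 : (0 <= M)%R by rewrite (le_trans _ (fM 0%N 0%R)).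
have mB : row_measurable (fun x => M * \1_B x)%R.
  apply: measurable_funM => //.
  rewrite (_ : (fun _ => _) = \1_(row @^-1` B)); last first.
    by apply/funext => t; rewrite /= !indicE.
  apply: measurable_indic; rewrite -[X in measurable X]setTI.
  rewrite (_ : row @^-1` B = (fun t : tup => `|row t|)%R @^-1` `]-oo, c]%classic).
    exact: row_measurable_norm.
  by apply/seteqP; split => t; rewrite /B /= in_itv.
apply: (@dominated_cvg _ _ _ mu setT measurableT (fun k t => (f_ k (row t))%:E) _
  (fun t => (M * \1_B (row t))%:E)) => //.
- by move=> k; apply/measurable_EFinP; exact: mf.
- by move=> t _; apply: cvg_EFin; [exact: nearW|exact: ff].
- apply: (@integrable_vanishing c M _ mB).
    by move=> x xc; rewrite indicE memNset ?mulr0//= => /(lt_le_trans xc); rewrite ltxx.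
  by move=> x; rewrite normrM (ger0_norm M0) indicE ler_piMr//;
    case: (_ \in _); rewrite ?normr1 ?normr0.
- move=> k t _; rewrite abse_EFin lee_fin indicE; have [tc|tc] := leP (`|row t|)%R c.
    by rewrite mem_set// mulr1.
  by rewrite fc// normr0 mulr_ge0.
Qed.

Lemma integral_translate f (a : 'rV[R]_n.+1) : row_measurable f ->
  \int[mu]_t (f (row t + a)%R)%:E = I f.
Proof.
move=> mf; rewrite integralE [RHS]integralE.
pose fp x := (maxr (f x) 0)%R; pose fm x := (maxr (- f x) 0)%R.
have mp : row_measurable fp by exact: measurable_maxr.
have mm : row_measurable fm by apply: measurable_maxr => //; exact: measurableT_comp.
have Ep (h : 'rV[R]_n.+1 -> 'rV[R]_n.+1) :
    (fun t : tup => (f (h (row t)))%:E)^\+ = fun t => (fp (h (row t)))%:E.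
  by apply/funext => t; rewrite funeposE -EFin_max.
have Em (h : 'rV[R]_n.+1 -> 'rV[R]_n.+1) :
    (fun t : tup => (f (h (row t)))%:E)^\- = fun t => (fm (h (row t)))%:E.
  by apply/funext => t; rewrite funenegE -EFin_max.
rewrite (Ep (fun x => x + a)%R) (Em (fun x => x + a)%R) (Ep id) (Em id).
rewrite (@ge0_integral_translate_row _ _ fp)// ?(@ge0_integral_translate_row _ _ fm)//.
- by move=> x; rewrite /fm le_max lexx orbT.
- by move=> x; rewrite /fp le_max lexx orbT.
Qed.

Lemma vanishes_partial c f i : vanishes_beyond c f ->
  vanishes_beyond c (partial i f).
Proof.
move=> fc x xc; have oc : open [set y : 'rV[R]_n.+1 | (c < `|y|)%R].
  apply: (@open_comp _ _ (fun z : 'rV[R]_n.+1 => `|z|)%R [set r : R | (c < r)%R]).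
    by move=> z _; exact: norm_continuous.
  exact: open_gt.
have nx : \forall y \near x, f y = 0%R.
  by apply: (filterS fc); exact: open_nbhs_nbhs.
rewrite /partial (@near_eq_derive _ _ _ f (cst 0%R))//.
exact: derive_cst.
Qed.

(** By translation invariance every difference quotient has integral 0; the quotients are uniformly
    bounded, vanish outside a common bounded set and converge to the partial derivative. *)
Lemma integral_partial_eq0 c f i : is_Ck 1 setT f -> vanishes_beyond c f ->
  I (partial i f) = 0.
Proof.
move=> kf fc; have cf := is_Ck_continuous kf.
have cp := is_Ck_continuous (is_Ck_partial i kf).
have pc := vanishes_partial i fc.
have [M pM] := vanishing_bounded cp pc.
pose e : 'rV[R]_n.+1 := delta_mx ord0 i.
have e1 : (`|e| <= 1)%R.
  apply: norm_rV_le => // j; rewrite mxE eqxx /=.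
  by case: (_ == _); rewrite ?normr1 ?normr0.
pose q (k : nat) x : R := (k.+1%:R * (f (x + k.+1%:R^-1 *: e) - f x))%R.
have ic : mu.-integrable setT (fun t => (f (row t))%:E) := integrable_continuous cf fc.
have cfs (k : nat) : continuous (fun x : 'rV[R]_n.+1 => f (x + k.+1%:R^-1 *: e)%R).
  exact: continuous_shift.
have cq k : continuous (q k).
  apply: continuous_mul; first exact: cst_continuous.
  by move=> x; exact: (continuousB (cfs k x) (cf x)).
have k1 (k : nat) : (0 <= (k.+1%:R^-1 : R) <= 1)%R by rewrite invr_ge0 ler0n invf_le1 ?ler1n ?ltr0n.
(* A shift of norm at most 1 enlarges the vanishing radius by at most 1, uniformly in [k]. *)
have fsc (k : nat) : vanishes_beyond (c + 1)%R (fun x => f (x + k.+1%:R^-1 *: e)%R).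
  move=> x xc; apply: fc; have := ler_normD (x + k.+1%:R^-1 *: e)%R (- (k.+1%:R^-1 *: e))%R.
  rewrite addrK normrN normrZ; have /andP[h0 h1] := k1 k; rewrite (ger0_norm h0).
  have : (k.+1%:R^-1 * `|e| <= 1)%R by rewrite mulr_ile1.
  move: xc; move: (_ * `|e|)%R (`|x + _|)%R (`|x|)%R => u w z ???; lra.
have q0 k : I (q k) = 0.
  have isk : mu.-integrable setT (fun t => (f (row t + k.+1%:R^-1 *: e)%R)%:E).
    exact: integrable_continuous (cfs k) (fsc k).
  rewrite (eq_integral (fun t => k.+1%:R%:E *
    ((f (row t + k.+1%:R^-1 *: e)%R)%:E - (f (row t))%:E))); last first.
    by move=> t _; rewrite -EFinB -EFinM.
  rewrite integralZl//; last exact: integrableB.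
  rewrite integralB_EFin// integral_translate; last exact: continuous_measurable_tuple.
  by rewrite subee ?mule0// integrable_fin_num.
(* The mean value theorem yields both the uniform bound [M] and the pointwise limit for dominated
   convergence. *)
have qE k x : exists2 s : R, (0 <= s <= 1)%R &
    q k x = partial i f ((s * k.+1%:R^-1) *: e + x)%R.
  have [s s01 sE] := @mean_value_line _ _ f (partial i f) x e
    (fun y => is_Ck_derive i y kf) k.+1%:R^-1.
  by exists s => //; rewrite /q (addrC x) sE mulrA divff ?mul1r// pnatr_eq0.
have : I (q k) @[k --> \oo] --> I (partial i f).
  apply: (@cvg_integral_vanishing (c + 1)%R M).
  - by move=> k; exact: continuous_measurable_tuple.
  - move=> k x xc; rewrite /q fsc// fc ?subr0 ?mulr0//.
    by rewrite (lt_trans _ xc)// ltrDl.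
  - by move=> k x; have [s _ ->] := qE k x.
  - move=> x; apply/cvgrPdist_lt => r r0.
    have /nbhs_ballP[d /= d0 dp] := cp x _ (nbhsx_ballx (partial i f x) r r0).
    near=> k; have [s /andP[s0 s1] ->] := qE k x; apply: dp.
    rewrite -ball_normE /= opprD addrCA subrr addr0 normrN normrZ normrM (ger0_norm s0).
    have /andP[h0 _] := k1 k; rewrite (ger0_norm h0).
    apply: (@le_lt_trans _ _ (k.+1%:R^-1)%R).
      apply: (@le_trans _ _ (k.+1%:R^-1 * `|e|)%R); last by rewrite ler_piMr.
      by rewrite -mulrA ler_piMl// mulr_ge0.
    by near: k; exact: near_infty_natSinv_lt (PosNum d0).
move=> /(cvg_lim (@ereal_hausdorff R)) <-.
under eq_fun do rewrite q0.
by rewrite lim_cst//; exact: ereal_hausdorff.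
Unshelve. all: by end_near. Qed.
End BoundedSupport.

(** * Test functions as elements of the Sobolev space *)

Section TestFunctions.
Variables (R : realType) (n : nat) (U : set 'rV[R]_n.+1).
Local Notation row := (@tuple_row R n.+1).
Local Notation I f := (\int[leb R n.+1]_t (f (tuple_row t))%:E)%E.
Implicit Types (f phi : 'rV[R]_n.+1 -> R) (x y : 'rV[R]_n.+1).

Lemma test_vanishes phi : test_function U phi -> exists c, vanishes_beyond c phi.
Proof.
move=> [_ cS _]; have [M M0 SM] := compact_norm_bound cS.
exists M => x Mx; apply: contrapT => /eqP px.
by have := SM x (@subset_closure _ [set y | phi y != 0] _ px); rewrite leNgt Mx.
Qed.

Lemma test_out phi x : test_function U phi -> ~ U x -> phi x = 0.
Proof.
move=> [_ _ SU] Ux; apply: contrapT => /eqP px; apply: Ux; apply: SU.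
exact: (@subset_closure _ [set y | phi y != 0] _ px).
Qed.

Lemma test_partial_out phi i x : test_function U phi -> ~ U x ->
  partial i phi x = 0.
Proof.
move=> [_ _ SU] Ux.
have oS : open (~` closure [set x | phi x != 0]).
  by apply: closed_openC; exact: closed_closure.
have nx : \forall y \near x, phi y = 0.
  have : nbhs x (~` closure [set x | phi x != 0]).
    by apply: open_nbhs_nbhs; split=> // /SU.
  by apply: filterS => y yS; apply: contrapT => /eqP py; apply: yS;
    exact: (@subset_closure _ [set z | phi z != 0] _ py).
by rewrite /partial (@near_eq_derive _ _ _ phi (cst 0))//; exact: derive_cst.
Qed.

Lemma test_continuous phi : test_function U phi -> continuous phi.
Proof. by move=> [kp _ _]; exact: is_Ck_continuous (kp 0). Qed.

Lemma test_partial_continuous phi i : test_function U phi -> continuous (partial i phi).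
Proof. by move=> [kp _ _]; exact: is_Ck_continuous (is_Ck_partial i (kp 1%N)). Qed.

Lemma eint_continuous_lty f c : continuous f -> vanishes_beyond c f ->
  (forall x, ~ U x -> f x = 0) -> eint U f \is a fin_num.
Proof.
move=> cf fc f0; rewrite eint_vanishing//; apply: integrable_fin_num => //.
exact: integrable_continuous cf fc.
Qed.

Lemma vanishes_mul c f g : vanishes_beyond c f -> vanishes_beyond c (fun x => f x * g x).
Proof. by move=> fc x xc; rewrite fc// mul0r. Qed.

Lemma L2_continuous f c : continuous f -> vanishes_beyond c f ->
  (forall x, ~ U x -> f x = 0) -> L2 U f.
Proof.
move=> cf fc f0; split.
  by apply: measurable_funTS; exact: continuous_measurable_tuple.
have /fin_numPlt/andP[] // : eint U (fun x => f x ^+ 2) \is a fin_num.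
apply: (@eint_continuous_lty _ c).
- exact: continuous_mul.
- exact: vanishes_mul.
- by move=> x Ux; rewrite f0// expr0n.
Qed.

(** Integration by parts: the partial derivative of the product of two test functions has integral
    0, and the product rule expands it. *)
Lemma test_weak_gradient phi : test_function U phi -> weak_gradient U phi (gradient phi).
Proof.
move=> tphi psi tpsi i.
have [c pc] := test_vanishes tphi.
have cp := test_continuous tphi; have cq := test_continuous tpsi.
have cdp := test_partial_continuous (i := i) tphi.
have cdq := test_partial_continuous (i := i) tpsi.
pose F x := phi x * partial i psi x; pose G x := psi x * partial i phi x.
have cF : continuous F by exact: continuous_mul.
have cG : continuous G by exact: continuous_mul.
have Fc : vanishes_beyond c F by exact: vanishes_mul.
have Gc : vanishes_beyond c G.
  by move=> x xc; rewrite /G (vanishes_partial i pc)// mulr0.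
rewrite /rint (_ : (fun x => gradient phi x ord0 i * psi x) = G); last first.
  by apply/funext => x; rewrite mxE mulrC.
rewrite !eint_vanishing; last 2 first.
- by move=> x Ux; rewrite /G (test_out tpsi Ux) mul0r.
- by move=> x Ux; rewrite (test_out tphi Ux) mul0r.
have iF := integrable_continuous cF Fc; have iG := integrable_continuous cG Gc.
have k1 : is_Ck 1 setT (fun x => phi x * psi x).
  by case: tphi => kp _ _; case: tpsi => kq _ _; exact: is_CkM.
have := integral_partial_eq0 i k1 (vanishes_mul psi pc).
rewrite (_ : partial i _ = fun x => F x + G x); last first.
  apply/funext => x; apply: derive_val.
  case: tphi => kp _ _; case: tpsi => kq _ _.
  exact: (is_deriveM (is_Ck_derive i x (kp 1%N)) (is_Ck_derive i x (kq 1%N))).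
under eq_integral do rewrite EFinD.
rewrite integralD_EFin//.
have fF := integrable_fin_num measurableT iF; have fG := integrable_fin_num measurableT iG.
move: fF fG; case: (I F) => // a _; case: (I G) => // b _ /eqP.
by rewrite -EFinD eqe addr_eq0 => /eqP.
Qed.

Lemma test_W12_0 phi : test_function U phi -> W12_0 U phi (gradient phi).
Proof.
move=> tphi; have [c pc] := test_vanishes tphi; split.
  split; last exact: test_weak_gradient.
    apply: L2_continuous (pc) _; first exact: test_continuous.
    by move=> x; exact: test_out.
  move=> i; rewrite (_ : (fun x => _) = partial i phi); last first.
    by apply/funext => x; rewrite mxE.
  apply: L2_continuous (vanishes_partial i pc) _; first exact: test_partial_continuous.
  by move=> x; exact: test_partial_out.
move=> e e0; exists phi => //; rewrite /W12_norm2 /eint integral0_eq// => t _.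
rewrite !subrr expr0n add0r /enorm /dot big1 ?sqrtr0 ?expr0n// => i _.
by rewrite mxE mul0r.
Qed.

End TestFunctions.

(** * From an eigenfunction to a test function with nearby Rayleigh quotient *)

Section EigenpairTest.
Variables (R : realType) (n : nat) (U : set 'rV[R]_n.+1).
Hypothesis oU : open U.
Local Notation row := (@tuple_row R n.+1).
Local Notation I f := (\int[leb R n.+1]_t (f (tuple_row t))%:E)%E.
Implicit Types (f p q phi u : 'rV[R]_n.+1 -> R) (g h : 'rV[R]_n.+1 -> 'rV[R]_n.+1).

Let D := row @^-1` U.
Let mD : measurable D. Proof. exact: measurable_tuple_open. Qed.

Lemma eint_ge0 f : (forall x, 0 <= f x) -> (0 <= eint U f)%E.
Proof. by move=> f0; apply: integral_ge0 => t _; rewrite lee_fin. Qed.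

Lemma le_eint_comb f p q (k l : R) : 0 <= k -> 0 <= l ->
  measurable_fun D (f \o row) -> measurable_fun D (p \o row) ->
  measurable_fun D (q \o row) ->
  (forall x, 0 <= f x) -> (forall x, 0 <= p x) -> (forall x, 0 <= q x) ->
  (forall x, f x <= k * p x + l * q x) ->
  (eint U f <= k%:E * eint U p + l%:E * eint U q)%E.
Proof.
move=> k0 l0 mf mp mq f0 p0 q0 fpq.
have mpE : measurable_fun D (fun t => (p (row t))%:E) by exact/measurable_EFinP.
have mqE : measurable_fun D (fun t => (q (row t))%:E) by exact/measurable_EFinP.
rewrite /eint -!ge0_integralZl//; try by move=> t _; rewrite lee_fin.
rewrite -ge0_integralD//.
- apply: ge0_le_integral => //.
  + by move=> t _; rewrite lee_fin.
  + exact/measurable_EFinP.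
  + by apply: emeasurable_funD; exact: measurable_funeM.
  + by move=> t _; rewrite -!EFinM -EFinD lee_fin.
- by move=> t _; rewrite mule_ge0// lee_fin.
- exact: measurable_funeM.
- by move=> t _; rewrite mule_ge0// lee_fin.
- exact: measurable_funeM.
Qed.

Lemma measurable_dot_row g h :
  (forall i, measurable_fun D ((fun x => g x ord0 i) \o row)) ->
  (forall i, measurable_fun D ((fun x => h x ord0 i) \o row)) ->
  measurable_fun D ((fun x => dot (g x) (h x)) \o row).
Proof.
move=> mg mh; apply: measurable_sum => i; apply: measurable_funM.
  exact: mg.
exact: mh.
Qed.

Lemma sqr_enorm (y : 'rV[R]_n.+1) : enorm y ^+ 2 = dot y y.
Proof. by rewrite sqr_sqrtr// dot_ge0. Qed.

(** Weighted Young inequality: the factor [1 + d] stays near 1, and the large factor [1 + d^-1]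
    falls on the difference, which approximation in W^{1,2} makes small. *)
Let young (x y d : R) : 0 < d ->
  y * y <= (1 + d) * (x * x) + (1 + d^-1) * ((y - x) * (y - x)).
Proof.
move=> d0; rewrite -subr_ge0.
have -> : (1 + d) * (x * x) + (1 + d^-1) * ((y - x) * (y - x)) - y * y =
   d^-1 * ((d * x - (y - x)) * (d * x - (y - x))).
  by field; rewrite gt_eqF.
by rewrite mulr_ge0 ?invr_ge0 ?(ltW d0)// -expr2 sqr_ge0.
Qed.

Let dot_young (x y : 'rV[R]_n.+1) (d : R) : 0 < d ->
  dot y y <= (1 + d) * dot x x + (1 + d^-1) * dot (y - x) (y - x).
Proof.
move=> d0; rewrite !mulr_sumr -big_split; apply: ler_sum => i _ /=.
by rewrite !mxE; exact: young.
Qed.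

Lemma L2_gradient_fin g : (forall i, L2 U (fun x => g x ord0 i)) ->
  eint U (fun x => dot (g x) (g x)) \is a fin_num.
Proof.
move=> Lg; have E0 := eint_ge0 (fun x => dot_ge0 (g x)).
rewrite ge0_fin_numE// /eint /dot.
under eq_integral do rewrite -sumEFin.
rewrite ge0_integral_sum//; last 2 first.
- move=> i; apply/measurable_EFinP; apply: measurable_funM; exact: (Lg i).1.
- by move=> i t _; rewrite lee_fin -expr2 sqr_ge0.
apply: lte_sum_pinfty => i _.
exact: (Lg i).2.
Qed.

Lemma eint_sqr_gt0 u : L2 U u -> ~ ae_zero U u -> (0 < eint U (fun x => (u x * u x)%R))%E.
Proof.
move=> [mu _] uz; rewrite lt_neqAle eint_ge0 ?andbT => [|x]; last by rewrite -expr2 sqr_ge0.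
apply/eqP => /esym E0; apply: uz.
have mu2 : measurable_fun D (fun t => (u (row t) * u (row t))%:E).
  by apply/measurable_EFinP; exact: measurable_funM.
have : ae_eq (leb R n.+1) D (fun t => (u (row t) * u (row t))%:E) (cst 0%E).
  apply/(ae_eq_integral_abs _ mD mu2); rewrite -E0; apply: eq_integral => t _.
  by rewrite gee0_abs// lee_fin -expr2 sqr_ge0.
apply: filterS => t /= h Ut; have := h Ut => /eqP.
by rewrite eqe -expr2 sqrf_eq0 => /eqP.
Qed.

(* The eigenfunction u lies in the W^{1,2}-closure of the test functions. *)
Lemma test_rayleigh_lt u g (mu c : R) : W12_0 U u g -> ~ ae_zero U u ->
  rint U (fun x => dot (g x) (g x)) = mu * rint U (fun x => u x * u x) ->
  mu < c -> exists2 phi, test_function U phi &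
    [/\ 0 <= c & (I (fun x => (dot (gradient phi x) (gradient phi x))) <
      c%:E * I (fun x => (phi x * phi x)%R))%E].
Proof.
move=> [[Lu Lg _] app] uz; rewrite /rint.
have A0 := eint_sqr_gt0 Lu uz.
have fA : eint U (fun x => (u x * u x)%R) \is a fin_num.
  by rewrite ge0_fin_numE ?ltW//; exact: Lu.2.
have fB := L2_gradient_fin Lg.
have B0 := eint_ge0 (fun x => dot_ge0 (g x)).
have EA := fineK fA; have EB := fineK fB.
set A := fine _ in EA; set B := fine _ in EB.
rewrite -EA lte_fin in A0; rewrite -EB lee_fin in B0.
move=> BA0 muc; have BA : B = mu * A := BA0.
have mu0 : 0 <= mu by rewrite -(pmulr_lge0 _ A0) -BA.
have c0 : 0 < c by exact: le_lt_trans muc.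
(* In the final estimate the loss is at most [3 * d * mu * A + (2 + c) * l * e]. This [d] keeps the
   first term at most half of [(c - mu) * A], and [e] makes the second a quarter of it. *)
pose d : R := minr 1 ((c - mu) / (6 * (mu + 1))).
have mu6 : 0 < 6 * (mu + 1) by rewrite mulr_gt0// ltr_wpDl.
have d0 : 0 < d by rewrite lt_min ltr01 divr_gt0// subr_gt0.
have d1 : d <= 1 by rewrite ge_min lexx.
have dc : d * (6 * (mu + 1)) <= c - mu by rewrite -ler_pdivlMr// ge_min lexx orbT.
pose l : R := 1 + d^-1.
have l0 : 0 < l by rewrite addr_gt0// invr_gt0.
pose e : R := (c - mu) * A / (4 * (l * (2 + c))).
have den0 : 0 < 4 * (l * (2 + c)) by rewrite !mulr_gt0// addr_gt0.
have e0 : 0 < e by rewrite divr_gt0// mulr_gt0// subr_gt0.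
have eE : l * e * (2 + c) = (c - mu) * A / 4.
  have <- : e * (4 * (l * (2 + c))) = (c - mu) * A by rewrite mulfVK// gt_eqF.
  by field.
clearbody e; have [phi tphi phie] := app e e0; exists phi => //; split; first exact: ltW.
have cphi := test_continuous tphi.
have mphi : measurable_fun D (phi \o row).
  by apply: measurable_funTS; exact: continuous_measurable_tuple.
have mdphi i : measurable_fun D ((fun x => gradient phi x ord0 i) \o row).
  apply: measurable_funTS.
  rewrite (_ : (fun x => _) = partial i phi); last by apply/funext => x; rewrite mxE.
  by apply: continuous_measurable_tuple; exact: test_partial_continuous tphi.
have mdg i : measurable_fun D ((fun x => (gradient phi x - g x) ord0 i) \o row).
  rewrite (_ : _ \o _ = (fun t => gradient phi (row t) ord0 i - g (row t) ord0 i)).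
    by apply: measurable_funB; [exact: mdphi|exact: (Lg i).1].
  by apply/funext => t; rewrite /= !mxE.
have mdd := measurable_dot_row mdg mdg.
have mgg := measurable_dot_row (fun i => (Lg i).1) (fun i => (Lg i).1).
have mpp := measurable_dot_row mdphi mdphi.
have [c1 pc] := test_vanishes tphi.
have oP x : ~ U x -> phi x * phi x = 0 by move=> Ux; rewrite (test_out tphi Ux) mul0r.
have oG x : ~ U x -> dot (gradient phi x) (gradient phi x) = 0.
  move=> Ux; rewrite /dot big1// => i _.
  by rewrite mxE (test_partial_out i tphi Ux) mul0r.
rewrite -(eint_vanishing oP) -(eint_vanishing oG).
have fP : eint U (fun x => (phi x * phi x)%R) \is a fin_num.
  by apply: (eint_continuous_lty (continuous_mul cphi cphi) (vanishes_mul phi pc) oP).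
have EP := fineK fP; set P := fine _ in EP.
have E1 : (eint U (fun x => ((phi x - u x) * (phi x - u x))%R) <= e%:E)%E.
  apply: le_trans (ltW phie); rewrite /W12_norm2.
  apply: ge0_le_integral => //.
  - by move=> t _; rewrite lee_fin -expr2 sqr_ge0.
  - apply/measurable_EFinP; have m1 : measurable_fun D (fun t => phi (row t) - u (row t)).
      by apply: measurable_funB => //; exact: Lu.1.
    exact: measurable_funM.
  - apply/measurable_EFinP; apply: measurable_funD.
      by apply: measurable_funX; apply: measurable_funB => //; exact: Lu.1.
    rewrite (_ : (fun t => _) =
      (fun x => dot (gradient phi x - g x) (gradient phi x - g x)) \o row).
      exact: mdd.
    by apply/funext => t; rewrite /= sqr_enorm.
  - by move=> t _; rewrite lee_fin expr2 lerDl sqr_ge0.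
have E2 : (eint U (fun x => dot (gradient phi x - g x)%R (gradient phi x - g x)%R) <= e%:E)%E.
  apply: le_trans (ltW phie); rewrite /W12_norm2.
  apply: ge0_le_integral => //.
  - by move=> t _; rewrite lee_fin dot_ge0.
  - by apply/measurable_EFinP; exact: mdd.
  - apply/measurable_EFinP; apply: measurable_funD.
      by apply: measurable_funX; apply: measurable_funB => //; exact: Lu.1.
    rewrite (_ : (fun t => _) =
      (fun x => dot (gradient phi x - g x) (gradient phi x - g x)) \o row).
      exact: mdd.
    by apply/funext => t; rewrite /= sqr_enorm.
  - by move=> t _; rewrite lee_fin sqr_enorm lerDr sqr_ge0.
have d0' : 0 <= 1 + d by rewrite addr_ge0// ltW.
have GB : (eint U (fun x => dot (gradient phi x) (gradient phi x)) <=
    ((1 + d) * B + l * e)%:E)%E.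
  apply: (@le_trans _ _ ((1 + d)%:E * eint U (fun x => dot (g x) (g x)) +
    l%:E * eint U (fun x => dot (gradient phi x - g x)%R (gradient phi x - g x)%R))%E).
    apply: le_eint_comb => //; try by move=> x; exact: dot_ge0.
    - exact: ltW.
    - by move=> x; exact: dot_young.
  by rewrite -EB [leRHS]EFinD !EFinM leeD2l// lee_wpmul2l// lee_fin ltW.
have AP : A <= (1 + d) * P + l * e.
  rewrite -lee_fin EA.
  apply: (@le_trans _ _ ((1 + d)%:E * eint U (fun x => (phi x * phi x)%R) +
    l%:E * eint U (fun x => ((phi x - u x) * (phi x - u x))%R))%E).
    apply: le_eint_comb => //; try by move=> x; rewrite -expr2 sqr_ge0.
    - exact: ltW.
    - by apply: measurable_funM; exact: Lu.1.
    - exact: measurable_funM.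
    - have m1 : measurable_fun D (fun t => phi (row t) - u (row t)).
        by apply: measurable_funB => //; exact: Lu.1.
      exact: measurable_funM.
    - move=> x; have := young (phi x) (u x) d0.
      by rewrite -[u x - phi x]opprB mulrNN.
  by rewrite -EP [leRHS]EFinD !EFinM leeD2l// lee_wpmul2l// lee_fin ltW.
apply: (le_lt_trans GB); rewrite -EP -EFinM lte_fin BA.
have d1' : 0 < 1 + d by rewrite addr_gt0.
(* After multiplication by [1 + d], the bound [AP] controls the right-hand side from below through
   [A - l * e]. *)
rewrite -(ltr_pM2l d1').
have hA : A - l * e <= (1 + d) * P by rewrite lerBlDr.
apply: (@lt_le_trans _ _ (c * (A - l * e))); last first.
  by rewrite [leRHS]mulrCA ler_pM2l.
have le0 : 0 < l * e by rewrite mulr_gt0.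
have dd : d * d <= d by rewrite ler_piMl// ltW.
have dmA : d * (6 * (mu + 1)) * A <= (c - mu) * A by rewrite ler_pM2r.
have dA : 0 < d * A by rewrite mulr_gt0.
have ddm : d * d * (mu * A) <= d * (mu * A) by rewrite ler_wpM2r// mulr_ge0// ltW.
have dle : d * (l * e) <= l * e by rewrite ler_piMl// ltW.
have cA : 0 < (c - mu) * A by rewrite mulr_gt0// subr_gt0.
clear -eE dmA ddm dle le0 dA cA; move: (l * e) eE dle le0 => w eE dle le0; lra.
Qed.
End EigenpairTest.

(** * Homogeneity of gauges and bounds for support functions *)

Section TransplantGeometry.
Variables (R : realType) (N : nat).
Implicit Types (x y z v : 'rV[R]_N) (K : set 'rV[R]_N).

Lemma max_formZ m (xi : 'I_m -> 'rV[R]_N) (l : R) z : 0 < l ->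
  max_form xi (fun=> 0) (l *: z) = l * max_form xi (fun=> 0) z.
Proof.
have le (s : R) w : 0 < s -> max_form xi (fun=> 0) (s *: w) <= s * max_form xi (fun=> 0) w.
  move=> s0; have [->|[j ->]] := max_form_cases xi (fun=> 0) (s *: w).
    by rewrite mulr_ge0 ?max_form_ge0// ltW.
  rewrite /affine_form addr0 dotZr ler_pM2l//.
  by have := le_affine_max xi (fun=> 0) j w; rewrite /affine_form addr0.
move=> l0; apply/eqP; rewrite eq_le le//=.
rewrite -ler_pdivlMl// (le_trans _ (le l^-1 _ _)) ?invr_gt0//.
by rewrite scalerA mulVf ?gt_eqF// scale1r.
Qed.

Lemma cauchy_schwarz_dot x y : dot x y * dot x y <= dot x x * dot y y.
Proof.
have [->|x0] := eqVneq x 0.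
  by rewrite -(scale0r (0 : 'rV[R]_N)) !dotZl !mul0r.
have := dot_ge0 (y - (dot x y / dot x x) *: x); have xx := dot_gt0 x0.
rewrite dot_sub_sqr (dotC y x) divfK ?gt_eqF// => h.
rewrite -subr_ge0; have := mulr_ge0 (ltW xx) h.
rewrite (_ : dot x x * (_ + _) = dot x x * dot y y - dot x y * dot x y)//.
by field; rewrite gt_eqF.
Qed.

(** As 0 lies in [K], the support function is nonnegative, so an upper bound may be squared. *)
Lemma support_function_sqr_le K v (b : R) : K 0 -> (forall y, K y -> `|dot v y| <= b) ->
  support_function K v ^+ 2 <= b ^+ 2.
Proof.
move=> K0 Kb.
have ub : ubound [set dot v y | y in K] b.
  by move=> _ [y Ky <-]; rewrite (le_trans (ler_norm _))// Kb.
have d0 : dot v 0 = 0 by rewrite -(scale0r (0 : 'rV[R]_N)) dotZr mul0r.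
have s0 : 0 <= support_function K v.
  by rewrite -d0; apply: ub_le_sup; [exists b|exists 0].
have sb : support_function K v <= b by apply: ge_sup => //; exists (dot v 0); exists 0.
by rewrite ler_sqr ?nnegrE// (le_trans s0).
Qed.
End TransplantGeometry.

(** * Supports compactly contained in the unit ball *)

Section UnitBall.
Variables (R : realType) (n : nat).
Implicit Types (x : 'rV[R]_n.+1) (phi : 'rV[R]_n.+1 -> R).

(** If [dot x x >= 1], scaling by [1 + d] leaves the ball although it moves [x] by less than [e]. *)
Lemma interior_unit_ball x : (unit_ball R n.+1)° x -> dot x x < 1.
Proof.
move=> /interiorP[e e0 eB]; rewrite ltNge; apply/negP => x1.
pose d : R := e / (2 * (`|x| + 1)).
have x10 : 0 < `|x| + 1 by rewrite ltr_wpDl.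
have d0 : 0 < d by rewrite divr_gt0// mulr_gt0.
have : unit_ball R n.+1 ((1 + d) *: x).
  apply: eB; rewrite scalerDl scale1r addrC addKr normrZ gtr0_norm//.
  rewrite /d mulrAC ltr_pdivrMr ?mulr_gt0// ltr_pM2l//.
  by have := normr_ge0 x; move: `|x| => w w0; lra.
rewrite /unit_ball /= => h.
have : dot ((1 + d) *: x) ((1 + d) *: x) <= 1.
  by rewrite -sqr_enorm expr_le1// sqrtr_ge0.
rewrite dotZl dotZr mulrA => h2.
have : 1 < (1 + d) * (1 + d) by nra.
have : (1 + d) * (1 + d) <= (1 + d) * (1 + d) * dot x x.
  by rewrite ler_peMr// mulr_ge0// addr_ge0// ltW.
lra.
Qed.

Lemma test_unit_ball_radius phi : test_function (unit_ball R n.+1)° phi ->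
  exists2 r : R, 0 < r < 1 &
    forall x, closure [set y | phi y != 0] x -> dot x x <= r * r.
Proof.
move=> [_ cS SB]; set S := closure _ in cS SB *.
have [S0|/set0P nS] := eqVneq S set0.
  by exists 2^-1 => [|x]; [rewrite invr_gt0 ltr0n invf_lt1 ?ltr1n|rewrite S0].
have cd : continuous (fun x : 'rV[R]_n.+1 => dot x x).
  by apply: continuous_sum => i; apply: continuous_mul; exact: coord_continuous.
have [x0 /set_mem Sx0 x0max] := EVT_max_rV nS cS (continuous_subspaceT cd).
have m1 := interior_unit_ball (SB _ Sx0); have m0 := dot_ge0 x0.
set m := dot x0 x0 in m1 m0 x0max.
(* The square of this radius exceeds [m], the largest squared norm on the support, by
   [(1 - m) ^+ 2 / 4]; and the radius is positive even if [m] is 0. *)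
exists ((1 + m) / 2); first by apply/andP; split; lra.
move=> x Sx; apply: (le_trans (x0max x (mem_set Sx))).
have := sqr_ge0 (1 - m); nra.
Qed.
End UnitBall.

(** The integral of a nonnegative function is a supremum over the simple functions below it, hence
    monotone for arbitrary functions. It serves for the energy integrand, which contains the
    supremum [support_function K]. *)
Lemma ge0_le_integral_nonmeasurable d (T : measurableType d) (R : realType)
    (mu : {measure set T -> \bar R}) (f g : T -> \bar R) :
  (forall x, 0 <= f x)%E -> (forall x, f x <= g x)%E ->
  (\int[mu]_x f x <= \int[mu]_x g x)%E.
Proof.
move=> f0 fg; have g0 x : (0 <= g x)%E by exact: le_trans (fg x).
rewrite !ge0_integralTE//; apply: le_ereal_sup => _ [h /= hf <-].
by exists h => //= x; exact: le_trans (fg x).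
Qed.

Lemma norm_le_of_dot (R : realType) N (x : 'rV[R]_N) (r : R) : 0 <= r ->
  dot x x <= r * r -> `|x| <= r.
Proof.
move=> r0 xr; apply: norm_rV_le => // i.
have h : x ord0 i * x ord0 i <= r * r.
  apply: le_trans xr; rewrite /dot (bigD1 i)//= lerDl; apply: sumr_ge0 => j _.
  by rewrite -expr2 sqr_ge0.
rewrite -(ler_pXn2r (n := 2))// ?nnegrE//.
by rewrite -normrX ger0_norm ?sqr_ge0.
Qed.

(** * The transplanted test function and its Rayleigh quotient *)

Section Transplant.
Variables (R : realType) (n m : nat) (K Omega : set 'rV[R]_n.+1).
Variables (x0 theta : 'rV[R]_n.+1) (t r : R) (xi : 'I_m -> 'rV[R]_n.+1).
Variable phi : 'rV[R]_n.+1 -> R.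
Hypotheses (t0 : 0 < t) (r0 : 0 < r).
Hypotheses (cK : compact K) (sK : origin_symmetric K) (K0 : K 0).
Hypothesis KO : forall y, K y -> Omega (x0 + t *: y).
Hypothesis xiK : forall j y, K y -> dot (xi j) y <= 1.
Hypothesis xi_inside : forall z, max_form xi (fun=> 0) z <= r -> K° z.
Hypothesis kphi : forall k, is_Ck k setT phi.
Hypothesis phir : forall x, closure [set y | phi y != 0] x -> dot x x <= r * r.
Hypothesis theta1 : dot theta theta = 1.
Local Notation I f := (\int[leb R n.+1]_t (f (tuple_row t))%:E)%E.
Implicit Types (x y z : 'rV[R]_n.+1) (H : 'rV[R]_n.+1 -> R).

(** The forms [eta j] lie in the polar body of t K, and [b] moves the centre to [x0]. Thus [q] is
    the gauge of t times the polytope cut out by [dot (xi j) y <= 1], and [p k z] smooths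
    [q (z - x0)]. *)
Let eta j := t^-1 *: xi j.
Let b j := - dot (eta j) x0.
Let p (k : nat) z := lse eta b k.+1%:R z.
Let q z := max_form eta (fun=> 0) z.

(* The gauge of K is only C^2 away from the origin; it is replaced by smooth
   approximations of the gauge of a polytope P with K in P and r P inside K. *)
Definition transplant k z := phi (p k z *: theta).

Let max_form_shift z : max_form eta b z = q (z - x0).
Proof.
by apply: eq_bigr => j _; rewrite /affine_form addr0 dotBr.
Qed.

Let q_scale z : q z = max_form xi (fun=> 0) (t^-1 *: z).
Proof.
by apply: eq_bigr => j _; rewrite /affine_form !addr0 dotZl dotZr.
Qed.

Let q_le_p k z : q (z - x0) <= p k z.
Proof. by rewrite -max_form_shift; apply: lse_ge_max; rewrite ltr0n. Qed.

Let q_ge0 z : 0 <= q z. Proof. exact: max_form_ge0. Qed.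

(** If [q z = 0], the whole ray through [z] satisfies the condition of [xi_inside] and lies in [K],
    against boundedness; the multiple of norm [M + 1] gives the contradiction. *)
Let q_gt0 z : z != 0 -> 0 < q z.
Proof.
move=> z0; rewrite lt_neqAle q_ge0 andbT eq_sym; apply/eqP => qz.
have [M M0 MK] := compact_norm_bound cK.
have nz : 0 < `|t^-1 *: z| by rewrite normr_gt0 scaler_eq0 invr_eq0 negb_or z0 gt_eqF.
have : K (((M + 1) / `|t^-1 *: z|) *: (t^-1 *: z)).
  apply: interior_subset; apply: xi_inside; rewrite max_formZ ?divr_gt0 ?addr_gt0//.
  by rewrite -q_scale qz mulr0 ltW.
move=> /MK; rewrite normrZ gtr0_norm ?divr_gt0 ?addr_gt0// divfK ?gt_eqF//.
by rewrite gerDl leNgt ltr01.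
Qed.

Let sub_interior z : q (z - x0) <= r -> Omega° z.
Proof.
rewrite q_scale => /xi_inside /interiorP[e e0 eK].
apply/interiorP; exists (t * e) => [|y yz]; first by rewrite mulr_gt0.
have -> : y = x0 + t *: (t^-1 *: (y - x0)).
  by rewrite scalerA divff ?gt_eqF// scale1r addrC subrK.
apply/KO/eK; rewrite -scalerBr opprB addrA subrK normrZ gtr0_norm ?invr_gt0//.
by rewrite ltr_pdivrMl.
Qed.

Let sub_bounded : exists c0 : R, forall z, c0 < `|z| -> r < q (z - x0).
Proof.
have [M M0 MK] := compact_norm_bound cK.
exists (`|x0| + t * M) => z; apply: contraPP => /negP; rewrite -leNgt q_scale => h.
have /MK := interior_subset (xi_inside h).
rewrite normrZ gtr0_norm ?invr_gt0// ler_pdivrMl// => zx; apply/negP; rewrite -leNgt.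
by rewrite -(subrK x0 z) (le_trans (ler_normD _ _))// addrC lerD2l.
Qed.

Let out_of_support s : r < s -> ~ closure [set y | phi y != 0] (s *: theta).
Proof.
move=> rs /phir; rewrite dotZl dotZr theta1 mulr1 leNgt; apply/negP; rewrite negbK.
by rewrite ltr_pM// ltW.
Qed.

Let is_Ck_p k l : is_Ck l setT (p k). Proof. exact: is_Ck_lse. Qed.

(** Since [p k z] dominates [q (z - x0)] and [phi] vanishes beyond [r] along [theta], the support
    stays in the closed set where [q (z - x0) <= r], which is bounded and inside the interior of
    [Omega]. *)
Lemma test_transplant k : test_function Omega° (transplant k).
Proof.
pose Z := [set z | q (z - x0) <= r].
have cZ : closed Z.
  apply: (@closed_comp _ _ (fun z => q (z - x0)) [set s : R | s <= r]).
    by move=> z _; apply: continuous_shift; exact: continuous_max_form.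
  exact: closed_le.
have [c0 hc0] := sub_bounded.
have SZ : closure [set z | transplant k z != 0] `<=` Z.
  rewrite [X in _ `<=` X](closure_id Z).1//; apply: closure_subset => z /=.
  apply: contraPP => /negP.
  rewrite -ltNge => rq; apply/negP; rewrite negbK; apply/eqP.
  have rp : r < p k z by exact: lt_le_trans (q_le_p k z).
  apply: contrapT => /eqP h; apply: (out_of_support rp).
  exact: (@subset_closure _ [set y | phi y != 0] _ h).
split.
- by move=> l; exact: is_Ck_comp_line.
- apply: bounded_closed_compact; last exact: closed_closure.
  exists c0; split; first exact: num_real.
  move=> s sc z /SZ; rewrite /Z /= => h; apply: ltW.
  by rewrite ltNge; apply/negP => /(lt_le_trans sc)/hc0; rewrite ltNge h.
- by move=> z /SZ; exact: sub_interior.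
Qed.

Definition energy_density x := dot (gradient phi x) (gradient phi x).

Lemma continuous_energy_density : continuous energy_density.
Proof.
apply: continuous_sum => i; rewrite (_ : (fun _ => _) =
    fun x => partial i phi x * partial i phi x); last first.
  by apply/funext => x; rewrite mxE.
apply: continuous_mul; exact: is_Ck_continuous (is_Ck_partial i (kphi 1%N)).
Qed.

Let continuous_phi2 : continuous (fun x => phi x * phi x).
Proof. apply: continuous_mul; exact: is_Ck_continuous (kphi 0). Qed.

Let phi_out x : ~ closure [set y | phi y != 0] x -> phi x * phi x = 0.
Proof.
move=> xS; rewrite (_ : phi x = 0) ?mul0r//; apply: contrapT => /eqP h; apply: xS.
exact: (@subset_closure _ [set y | phi y != 0] _ h).
Qed.

Let energy_out x : ~ closure [set y | phi y != 0] x -> energy_density x = 0.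
Proof.
(* Here [phi] is regarded as a test function on its own closed support. *)
move=> xS; have tphi : test_function (closure [set y | phi y != 0]) phi.
  split=> //; apply: bounded_closed_compact; last exact: closed_closure.
  exists r; split; first exact: num_real.
  move=> s sr y /phir /(norm_le_of_dot (ltW r0)) yr.
  exact: le_trans yr (ltW sr).
by rewrite /energy_density /dot big1// => i _; rewrite mxE (test_partial_out i tphi xS) mul0r.
Qed.

(** The gradient is [a] times a sub-convex combination of the [eta j], whose products with points of
    [K] are at most [t^-1]; symmetry of [K] makes the bound two-sided. Cauchy-Schwarz with the unit
    vector [theta] bounds [a ^+ 2] by the energy density. *)
Lemma support_gradient_transplant k z :
  support_function K (gradient (transplant k) z) ^+ 2 <=
  t ^- 2 * energy_density (p k z *: theta).
Proof.
set a := dot theta (gradient phi (p k z *: theta)).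
have gE y : dot (gradient (transplant k) z) y =
    a * \sum_j lse_weight eta b k.+1%:R j z * dot (eta j) y.
  rewrite -dot_suml -dotZl; congr dot; apply/rowP => i.
  rewrite !mxE /transplant partial_comp_line// partial_lse ?pnatr_eq0//.
  by rewrite summxE; congr (_ * _); apply: eq_bigr => j _; rewrite !mxE.
have le1 y : K y -> \sum_j lse_weight eta b k.+1%:R j z * dot (eta j) y <= t^-1.
  move=> Ky; apply: (@le_trans _ _ (\sum_j lse_weight eta b k.+1%:R j z * t^-1)).
    apply: ler_sum => j _; rewrite ler_wpM2l ?lse_weight_ge0// dotZl.
    by rewrite ler_piMr ?invr_ge0 ?xiK// ltW.
  by rewrite -mulr_suml ler_piMl ?lse_weight_sum// invr_ge0 ltW.
have h y : K y -> `|dot (gradient (transplant k) z) y| <= `|a| * t^-1.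
  move=> Ky; rewrite gE normrM ler_wpM2l// ler_norml le1// andbT lerNl.
  rewrite -sumrN; under eq_bigr do rewrite -mulrN -dotNr.
  by apply/le1/sK.
apply: (le_trans (support_function_sqr_le K0 h)).
rewrite exprMn exprVn mulrC ler_wpM2l ?invr_ge0 ?exprn_ge0 ?(ltW t0)//.
rewrite -normrX ger0_norm ?sqr_ge0// expr2.
by apply: (le_trans (cauchy_schwarz_dot theta _)); rewrite theta1 mul1r.
Qed.

(** Dominated convergence: the integrands share a bound and vanish outside one bounded set for all
    [k]. Translation invariance removes [x0] from the limit. *)
Let cvg_transplant_integral H : continuous H ->
  (forall x, ~ closure [set y | phi y != 0] x -> H x = 0) ->
  I (fun z => H (p k z *: theta)) @[k --> \oo] --> I (fun z => H (q z *: theta)).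
Proof.
move=> cH H0.
have cq : continuous q by exact: continuous_max_form.
have cqs : continuous (fun z : 'rV[R]_n.+1 => q (z - x0)) by exact: continuous_shift.
have cl (s : 'rV[R]_n.+1 -> R) : continuous s ->
    continuous (fun z : 'rV[R]_n.+1 => H (s z *: theta)).
  move=> cs; apply: (@continuous_compT _ _ _ (fun z => s z *: theta) H) => // z.
  exact: continuousZr_tmp (cs z).
have [c0 hc0] := sub_bounded.
have [M HM] : exists M, forall x, `|H x| <= M.
  apply: (@vanishing_bounded _ _ r) => // x xr; apply: H0.
  by move=> /phir /(norm_le_of_dot (ltW r0)); rewrite leNgt xr.
rewrite -(@integral_translate _ _ (fun z => H (q z *: theta)) (- x0)); last first.
  by apply: continuous_measurable_tuple; exact: cl.
apply: (@cvg_integral_vanishing _ _ c0 M (fun k z => H (p k z *: theta))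
  (fun z => H (q (z - x0) *: theta))).
- move=> k; apply: continuous_measurable_tuple; apply: (cl (p k)).
  exact: is_Ck_continuous (is_Ck_p k 0).
- move=> k z /hc0 rz; apply/H0/out_of_support; exact: lt_le_trans (q_le_p k z).
- by move=> k z; exact: HM.
- move=> z; rewrite -max_form_shift.
  have cs : continuous (fun s : R => H (s *: theta)).
    apply: (@continuous_compT _ _ _ (fun s : R => s *: theta) H) => // s.
    by apply: continuousZr_tmp; exact: cvg_id.
  exact: (cvg_comp _ _ (@cvg_lse _ _ _ eta b z) (cs _)).
Qed.

Let energy_ge0 x : 0 <= energy_density x. Proof. exact: dot_ge0. Qed.

Let phi2_ge0 x : 0 <= phi x * phi x. Proof. by rewrite -expr2 sqr_ge0. Qed.

Let integrable_transplant k H : continuous H ->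
  (forall x, ~ closure [set y | phi y != 0] x -> H x = 0) ->
  I (fun z => H (p k z *: theta)) \is a fin_num.
Proof.
move=> cH H0; have [c0 hc0] := sub_bounded.
apply: integrable_fin_num => //.
apply: (@integrable_continuous _ _ c0 (fun z => H (p k z *: theta))).
  apply: (@continuous_compT _ _ _ (fun z => p k z *: theta) H) => // z.
  by apply: continuousZr_tmp; exact: (is_Ck_continuous (is_Ck_p k 0)).
by move=> z /hc0 rz; apply/H0/out_of_support; exact: lt_le_trans (q_le_p k z).
Qed.

Let integrable_gauge H : continuous H ->
  (forall x, ~ closure [set y | phi y != 0] x -> H x = 0) ->
  I (fun z => H (q z *: theta)) \is a fin_num.
Proof.
move=> cH H0; have [c0 hc0] := sub_bounded.
apply: integrable_fin_num => //.
apply: (@integrable_continuous _ _ (c0 + `|x0|) (fun z => H (q z *: theta))).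
  apply: (@continuous_compT _ _ _ (fun z => q z *: theta) H) => // z.
  by apply: continuousZr_tmp; exact: continuous_max_form.
move=> z zc; apply/H0/out_of_support; rewrite -(addrK x0 z); apply: hc0.
rewrite -ltrBrDr in zc; apply: (lt_le_trans zc).
by rewrite lerBlDr; have := ler_normB (z + x0) x0; rewrite addrK.
Qed.

Let integral_phi2_gt0 : (0 < ray (fun x => (phi x * phi x)%R) theta)%E ->
  (0 < I (fun z => (phi (q z *: theta) * phi (q z *: theta))%R))%E.
Proof.
move=> ray0.
have [s s0 Fs] : exists2 s, 0 < s & phi (s *: theta) * phi (s *: theta) != 0.
  apply: contrapT => h; move: ray0; rewrite /ray integral0_eq ?ltxx// => s _.
  rewrite indicE mem_setE in_itv /= andbT; case: (ltP 0 s) => s0; last by rewrite !mul0r.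
  rewrite (_ : phi _ * phi _ = 0) ?mulr0//; apply: contrapT => /eqP Fs.
  by apply: h; exists s.
pose e : 'rV[R]_n.+1 := delta_mx ord0 ord0.
have e0 : e != 0.
  by apply/eqP => /rowP/(_ ord0); rewrite !mxE !eqxx => /eqP; rewrite oner_eq0.
have qe := q_gt0 e0.
(* The chosen point is the multiple of [e] at which [q] takes the value [s]. *)
apply: (@integral_gt0 _ _ (fun z => phi (q z *: theta) * phi (q z *: theta))
  ((s / q e) *: e)) => //.
- apply: (@continuous_compT _ _ _ (fun z => q z *: theta) (fun x => phi x * phi x)) => // z.
  by apply: continuousZr_tmp; exact: continuous_max_form.
- rewrite (_ : q _ = s)//.
  by rewrite [LHS]max_formZ ?divr_gt0// -/(q e) divfK ?gt_eqF.
Qed.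

Lemma le_eint_integral (U : set 'rV[R]_n.+1) (f g : 'rV[R]_n.+1 -> R) :
  (forall x, 0 <= f x) -> (forall x, f x <= g x) -> (eint U f <= I g)%E.
Proof.
move=> f0 fg; rewrite /eint integral_mkcond; apply: ge0_le_integral_nonmeasurable => s.
  by rewrite /patch; case: ifP => // _; rewrite lee_fin.
rewrite /patch; case: ifP => _; rewrite lee_fin; first exact: fg.
exact: le_trans (f0 _) (fg _).
Qed.

(** For the gauge itself the ray inequality gives [B <= c * A] with [A > 0]. The larger constant
    [c'] opens a strict gap, which persists for some smooth approximation. *)
Lemma transplant_rayleigh (c c' : R) : 0 <= c -> c < c' ->
  (0 < ray (fun x => (phi x * phi x)%R) theta)%E ->
  (ray energy_density theta <= c%:E * ray (fun x => (phi x * phi x)%R) theta)%E ->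
  exists k, ~ ae_zero Omega° (transplant k) /\
    rint Omega° (fun x => support_function K (gradient (transplant k) x) ^+ 2) /
    rint Omega° (fun x => transplant k x ^+ 2) <= c' * t ^- 2.
Proof.
move=> c0 cc' ray0 rayc.
pose F x := phi x * phi x.
have A0 := integral_phi2_gt0 ray0.
have fA := integrable_gauge continuous_phi2 phi_out.
have fB := integrable_gauge continuous_energy_density energy_out.
have cvA := cvg_transplant_integral continuous_phi2 phi_out.
have cvB := cvg_transplant_integral continuous_energy_density energy_out.
have BA : (I (fun z => energy_density (q z *: theta)) <=
    c%:E * I (fun z => F (q z *: theta)))%E.
  apply: (@integral_gauge_le _ _ F energy_density q) => //.
  - exact: continuous_energy_density.
  - exact: continuous_max_form.
  - by move=> l y l0; exact: max_formZ.
have fFk k := integrable_transplant k continuous_phi2 phi_out.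
have fGk k := integrable_transplant k continuous_energy_density energy_out.
pose Fk k := fine (I (fun z => F (p k z *: theta))).
pose Gk k := fine (I (fun z => energy_density (p k z *: theta))).
rewrite -(fineK fA) in A0 BA cvA; rewrite -(fineK fB) in BA cvB.
set A := fine _ in A0 BA cvA; set B := fine _ in BA cvB.
rewrite lte_fin in A0; rewrite -EFinM lee_fin in BA.
have cvF : Fk k @[k --> \oo] --> A by exact: fine_cvg cvA.
have cvG : Gk k @[k --> \oo] --> B by exact: fine_cvg cvB.
have cvD : c' * Fk k - Gk k @[k --> \oo] --> c' * A - B.
  by apply: cvgB => //; apply: cvgMr.
have D0 : 0 < c' * A - B by rewrite subr_gt0 (le_lt_trans BA)// ltr_pM2r.
have [k _ /(_ k (leqnn k))] := cvgr_gt _ cvD _ D0.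
rewrite /= subr_gt0 => GF; exists k.
have c'0 : 0 < c' by exact: le_lt_trans cc'.
have Gk0 : 0 <= Gk k.
  by apply: fine_ge0; apply: integral_ge0 => s _; rewrite lee_fin energy_ge0.
(* The inequality [Gk k < c' * Fk k] with [Gk k >= 0] also shows that the transplant is nonzero. *)
have Fk0 : 0 < Fk k by rewrite -(pmulr_rgt0 _ c'0) (le_lt_trans Gk0).
have tk := test_transplant k.
have EF : eint Omega° (fun x => transplant k x ^+ 2) = (Fk k)%:E.
  rewrite eint_vanishing; last by move=> x xO; rewrite (test_out tk xO) expr0n.
  by rewrite /Fk fineK; last exact: fFk k.
split.
  move=> az; have : eint Omega° (fun x => transplant k x ^+ 2) = 0%E.
    rewrite /eint (@ae_eq_integral _ _ _ _ _ (cst 0%E)) ?integral0//.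
    - by apply: measurable_tuple_open; exact: open_interior.
    - apply/measurable_EFinP/measurable_funX/measurable_funTS.
      by apply: continuous_measurable_tuple; exact: test_continuous tk.
    - by apply: filterS az => s /= h Us; rewrite h// expr0n.
  by rewrite EF => -[] h; rewrite h ltxx in Fk0.
rewrite {2}/rint EF /= ler_pdivrMr//.
have hle : (eint Omega° (fun x => (support_function K (gradient (transplant k) x) ^+ 2)%R) <=
    (t ^- 2 * Gk k)%:E)%E.
  apply: (@le_trans _ _ (I (fun z => t ^- 2 * energy_density (p k z *: theta))%R)).
    apply: (@le_eint_integral Omega°
      (fun x => support_function K (gradient (transplant k) x) ^+ 2)
      (fun z => t ^- 2 * energy_density (p k z *: theta))) => x; first exact: sqr_ge0.
    exact: support_gradient_transplant.
  rewrite EFinM /Gk fineK; last exact: fGk k.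
  under eq_integral do rewrite EFinM.
  rewrite ge0_integralZl//.
  - apply/measurable_EFinP.
    apply: (@continuous_measurable_tuple _ _ (fun z => energy_density (p k z *: theta))).
    apply: (@continuous_compT _ _ _ (fun z => p k z *: theta) energy_density) => // z.
    by apply: continuousZr_tmp; exact: (is_Ck_continuous (is_Ck_p k 0)).
    exact: continuous_energy_density.
  - by move=> s _; rewrite lee_fin energy_ge0.
  - by rewrite lee_fin invr_ge0 exprn_ge0// ltW.
have h0 : (0 <= eint Omega° (fun x => (support_function K (gradient (transplant k) x) ^+ 2)%R))%E.
  by apply: eint_ge0 => x; exact: sqr_ge0.
apply: (@le_trans _ _ (t ^- 2 * Gk k)).
  rewrite -lee_fin /rint fineK//.
  by rewrite ge0_fin_numE// (le_lt_trans hle)// ltry.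
rewrite [leRHS]mulrAC [leRHS]mulrC ler_pM2l; first exact: ltW.
by rewrite invr_gt0 exprn_gt0.
Qed.
End Transplant.

(** * Comparison with the ball and passage to the inradius *)

Section Comparison.
Variables (R : realType) (n : nat) (K Omega : set 'rV[R]_n.+1).
Hypotheses (hK : convex_body K) (sK : origin_symmetric K) (hOmega : convex_body Omega).

Let iK : K° 0.
Proof. by case: hK => _ vK nK; exact: symmetric_interior0. Qed.

Lemma principal_frequency_le (mu c t : R) (x0 : 'rV[R]_n.+1) :
  dirichlet_eigenvalue (unit_ball R n.+1)° mu -> mu < c -> 0 < t ->
  (forall y, K y -> Omega (x0 + t *: y)) ->
  (principal_frequency K Omega <= (c * t ^- 2)%:E)%E.
Proof.
move=> [u [g [Wu uz eig]]] muc t0 KO; have [cK vK _] := hK.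
(* The gap between [mu] and [c] is spent in two halves: [mu] to [d] for replacing the eigenfunction
   by a test function, [d] to [c] for smoothing the gauge. *)
have [mid1 mid2] := midf_lt muc; set d := (mu + c) / 2 in mid1 mid2.
have [phi tphi [d0 lt]] := test_rayleigh_lt (@open_interior _ _) Wu uz (eig u g Wu) mid1.
have [kphi _ _] := tphi.
have [r r01 phir] := test_unit_ball_radius tphi; have /andP[r0 _] := r01.
have [m [xi [xiK xi_in]]] := polytope_inside cK vK iK r01.
have cF : continuous (fun x => phi x * phi x).
  by apply: continuous_mul; exact: is_Ck_continuous (kphi 0).
have cG := continuous_energy_density kphi.
have F0 x : 0 <= phi x * phi x by rewrite -expr2 sqr_ge0.
have G0 x : 0 <= energy_density phi x by exact: dot_ge0.
have mF : row_measurable (fun x => phi x * phi x) by exact: continuous_measurable_tuple.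
have mG : row_measurable (energy_density phi) by exact: continuous_measurable_tuple.
have [y y0 ylt] := ray_lt_of_integral_lt d0 mF mG F0 G0 lt.
have yy := dot_gt0 y0.
(* Both rays scale by the same factor, so [y] may be normalised to a unit direction. *)
pose l := (enorm y)^-1.
have l0 : 0 < l by rewrite invr_gt0 sqrtr_gt0.
have th1 : dot (l *: y) (l *: y) = 1.
  rewrite dotZl dotZr mulrA -invfM -expr2 sqr_enorm mulVf// gt_eqF//.
have ln0 : (0 < (l ^- n.+1)%:E)%E by rewrite lte_fin invr_gt0 exprn_gt0.
have rayF : (0 < ray (fun x => (phi x * phi x)%R) (l *: y))%E.
  (* A vanishing ray of [phi] squared would turn [ylt] into a negative ray energy. *)
  rewrite ray_scale// mule_gt0// lt_neqAle ray_ge0// andbT; apply/eqP => rF.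
  by move: ylt; rewrite -rF mule0 ltNge ray_ge0.
have rayle : (ray (energy_density phi) (l *: y) <=
    d%:E * ray (fun x => (phi x * phi x)%R) (l *: y))%E.
  by rewrite !ray_scale// muleCA lee_wpmul2l// ltW.
have [k [kz kle]] := transplant_rayleigh t0 r0 cK sK (interior_subset iK) KO xiK xi_in
  kphi phir th1 d0 mid2 rayF rayle.
apply: le_trans (_ : (_ <= (_ / _)%:E)%E) _; last by rewrite lee_fin; exact: kle.
apply: ereal_inf_lbound.
set Psi := transplant _ _ _ _ _ _; exists Psi, (gradient Psi); split=> //.
by apply: test_W12_0; exact: (test_transplant t0 r0 cK KO xi_in kphi phir th1).
Qed.

Let S := [set t | 0 <= t /\ exists2 x, Omega x & forall y, K y -> Omega (x + t *: y)].

(** The real [sup] is meaningful only on a bounded set. For [y] in [K] of norm [e / 2], both [x] and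
    [x + t *: y] lie in [Omega], whence [t * (e / 2) <= 2 * M]. *)
Lemma inradius_has_ubound : has_ubound S.
Proof.
have /interiorP[e e0 eK] := iK.
have [cO _ _] := hOmega; have [M M0 MO] := compact_norm_bound cO.
exists (4 * M / e) => t [t0 [x Ox xO]].
pose d : 'rV[R]_n.+1 := delta_mx ord0 ord0.
have d0 : 0 < `|d|.
  rewrite normr_gt0; apply/eqP => /rowP/(_ ord0); rewrite !mxE !eqxx => /eqP.
  by rewrite oner_eq0.
pose y := (e / 2 / `|d|) *: d.
have ye : `|y| = e / 2.
  by rewrite normrZ gtr0_norm ?divr_gt0// divfK// gt_eqF.
have Ky : K y by apply: eK; rewrite subr0 ye ltr_pdivrMr// ltr_pMr// ltr1n.
have := ler_normB (x + t *: y) x; rewrite addrAC subrr add0r normrZ ye ger0_norm//.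
have := MO _ (xO _ Ky); have := MO _ Ox; rewrite ler_pdivlMr// => h1 h2 h3; lra.
Qed.

Lemma inradius_witness : exists2 t, 0 < t & S t.
Proof.
have [cK _ _] := hK; have [M M0 MK] := compact_norm_bound cK.
have [_ _ [x /[dup] /interior_subset Ox /interiorP[e e0 eO]]] := hOmega.
have h : 0 < e / (2 * M) by rewrite divr_gt0// mulr_gt0.
(* Points of [K] have norm at most [M], so this multiple of [K] stays within distance [e / 2] of its
   centre. *)
exists (e / (2 * M)) => //; split; first exact: ltW.
exists x => // y /MK yM; apply: eO; rewrite addrC addKr normrZ gtr0_norm//.
rewrite mulrAC ltr_pdivrMr ?mulr_gt0// ltr_pM2l//.
by rewrite (le_lt_trans yM)// ltr_pMl// ltr1n.
Qed.

Lemma inradius_gt0 : 0 < inradius K Omega.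
Proof.
have [t t0 St] := inradius_witness.
by apply: (lt_le_trans t0); apply: ub_le_sup => //; exact: inradius_has_ubound.
Qed.

(** Here [c] tends to [mu] and [t] ranges over all admissible dilations; the inradius enters as
    their supremum. *)
Lemma principal_frequency_mul_le (mu : R) : dirichlet_eigenvalue (unit_ball R n.+1)° mu ->
  (principal_frequency K Omega * (inradius K Omega ^+ 2)%:E <= mu%:E)%E.
Proof.
move=> emu; have R0 := inradius_gt0.
have R20 : 0 < inradius K Omega ^+ 2 by rewrite exprn_gt0.
have [t1 t10 St1] := inradius_witness.
have bnd c t : mu < c -> 0 < t -> S t ->
    (principal_frequency K Omega <= (c * t ^- 2)%:E)%E.
  by move=> muc t0 [_ [x _ xO]]; exact: (principal_frequency_le emu muc t0 xO).
case E : (principal_frequency K Omega) => [a| |].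
- have at2 t : 0 < t -> S t -> a * t ^+ 2 <= mu.
    move=> t0 St; apply/ler_addgt0Pr => e e0.
    have := bnd (mu + e) t; rewrite E lee_fin ltrDl => /(_ e0 t0 St).
    by rewrite ler_pdivlMr// exprn_gt0.
  (* For [a <= 0] the single admissible value [t1], at most the inradius, suffices. For [a > 0]
     every admissible [t] is at most the square root of [mu / a], hence so is their supremum. *)
  rewrite -EFinM lee_fin; have [a0|a0] := leP a 0.
    apply: le_trans (at2 _ t10 St1); rewrite ler_wnM2l// ler_sqr ?nnegrE ?(ltW t10) ?(ltW R0)//.
    by apply: ub_le_sup => //; exact: inradius_has_ubound.
  rewrite -ler_pdivlMl// -(ler_sqrt _ _) ?sqrtr_sqr ?ger0_norm ?(ltW R0)//; last first.
    rewrite mulr_ge0 ?invr_ge0 ?(ltW a0)//.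
    by apply: le_trans (at2 _ t10 St1); rewrite mulr_ge0 ?sqr_ge0 ?ltW.
  apply: ge_sup; first by exists t1.
  move=> t St; have [t0|t0] := leP t 0; first by rewrite (le_trans t0)// sqrtr_ge0.
  rewrite -[t]ger0_norm ?(ltW t0)// -sqrtr_sqr ler_wsqrtr// ler_pdivlMl//.
  exact: at2.
- by have := bnd (mu + 1) t1; rewrite E leye_eq ltrDl ltr01 => /(_ isT t10 St1).
- by rewrite gt0_mulNye ?leNye// lte_fin.
Qed.
End Comparison.

Theorem proposition5p1 (R : realType) (n : nat) (K Omega : set 'rV[R]_n.+1)
    (hK : convex_body K) (hK2 : C2_plus K) (hKs : origin_symmetric K)
    (hOmega : convex_body Omega) :
  (principal_frequency K Omega <=
   lambda1 (unit_ball R n.+1) * (inradius K Omega ^- 2)%:E)%E.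
Proof.
have R0 := exprn_gt0 2 (inradius_gt0 hK hKs hOmega).
(* The power of the inradius goes to the left first, so that the infimum [lambda1] stands alone and
   can be tested against each eigenvalue. *)
rewrite lee_pdivlMr//; apply: le_ereal_inf_tmp => _ [mu emu <-].
exact: principal_frequency_mul_le.
Qed.
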